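(* Let $G$ be a finite group, $k$ an algebraically closed field of characteristic zero, and $\mathcal{C}=\operatorname{Rep}(D(G))$. The assignments $\mathcal{D}\mapsto(K_{\mathcal{D}},H_{\mathcal{D}},B_{\mathcal{D}})$ and $(K,H,B)\mapsto\mathcal{S}(K,H,B)$ are inverses of each other. Thus there is a bijection between the set of fusion subcategories of $\mathcal{C}$ and the set of triples $(K,H,B)$, where $K,H\subseteq G$ are normal subgroups of $G$ centralizing each other and $B:K\times H\to k^\times$ is a $G$-invariant bicharacter.
   Context: $D(G)$ is the Drinfeld double of $kG$; $\operatorname{Rep}(D(G))$ (finite-dimensional modules) is a modular category, equivalent as a braided fusion category to the category of $G$-equivariant vector bundles on $G$ ($G$ acting on itself by conjugation). Let $R$ be a set of representatives of the conjugacy classes of $G$, $e$ the identity. Isomorphism classes of simple objects are identified with $\Gamma=\{(a,\chi): a\in R,\ \chi \text{ an irreducible character of } C_G(a)\}$: $(a,\chi)$ is the simple equivariant bundle supported on the conjugacy class of $a$ with $C_G(a)$ acting on the fiber over $a$ with character $\chi$. A fusion subcategory is a full subcategory, closed under isomorphism, that contains the unit object and is closed under finite direct sums, direct summands, tensor products and duals. For a fusion subcategory $\mathcal{D}$ of $\mathcal{C}$: $K_{\mathcal{D}}=\{gag^{-1}: g\in G,\ (a,\chi)\in\mathcal{D}\cap\Gamma\text{ for some }\chi\}$ (the support of $\mathcal{D}$, a normal subgroup); $H_{\mathcal{D}}=\bigcap_{\chi:(e,\chi)\in\mathcal{D}}\operatorname{Ker}(\chi)$, where $\operatorname{Ker}(\chi)=\{g\in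 G:\chi(g)=\deg\chi\}$; $B_{\mathcal{D}}:K_{\mathcal{D}}\times H_{\mathcal{D}}\to k^\times$ is given by $B_{\mathcal{D}}(g^{-1}ag,h)=\chi(ghg^{-1})/\deg\chi$ for $(a,\chi)\in\mathcal{D}\cap\Gamma$, $g\in G$, $h\in H_{\mathcal{D}}$ (this is well defined, $K_{\mathcal D}$ and $H_{\mathcal D}$ centralize each other, and $B_{\mathcal D}$ is a $G$-invariant bicharacter). Subgroups $K,H$ centralize each other if they commute elementwise. A bicharacter $B:K\times H\to k^\times$ is a map multiplicative in each argument; it is $G$-invariant if $B(xkx^{-1},xhx^{-1})=B(k,h)$ for all $x\in G,k\in K,h\in H$. For such a triple $(K,H,B)$, $\mathcal{S}(K,H,B)$ is the full subcategory of $\mathcal{C}$ whose objects are the finite direct sums of simple objects $(a,\chi)\in\Gamma$ with $a\in K\cap R$ and $\chi(h)=B(a,h)\deg\chi$ for all $h\in H$; it is a fusion subcategory of $\mathcal{C}$. *)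

(* Defs.v *)
From HB Require Import structures.
From mathcomp Require Import all_boot all_order all_algebra all_fingroup.
From mathcomp Require Import all_character.
From mathcomp Require Import mxtens boolp classical_sets functions.

Set Implicit Arguments.
Unset Strict Implicit.
Unset Printing Implicit Defensive.

Import GRing.Theory.
Local Open Scope ring_scope.

(* D(G) is the smash product k^G # kG.  With e_g the indicator function of g,  *)
(* it has the basis (e_g x)_(g, x in G), and                                   *)
(*   (e_g x)(e_h y) = e_g xy if g = x h x^-1, and 0 otherwise;                 *)
(*   1 = \sum_g e_g 1;           Delta(e_g x) = \sum_(st = g) e_s x (x) e_t x; *)
(*   eps(e_g x) = [g = 1];       S(e_g x) = e_(x^-1 g^-1 x) x^-1.              *)
(* An element u is encoded by its coordinates: u (g, x) is that of e_g x.      *)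
Definition double (k : fieldType) (gT : finGroupType) :=
  {ffun gT * gT -> k^o}.

Section Double.

Variables (k : fieldType) (gT : finGroupType).

Local Notation DG := (double k gT).

HB.instance Definition _ := GRing.Lmodule.on DG.

Definition dbl_one : DG := [ffun p => (p.2 == 1%g)%:R].

Definition dbl_mul (u v : DG) : DG :=
  [ffun p => \sum_(x : gT) u (p.1, x) * v ((p.1 ^ x)%g, (x^-1 * p.2)%g)].

Lemma dbl_mulA : associative dbl_mul.
Proof.
move=> u v w; apply/ffunP=> -[g z]; rewrite !ffunE /=.
under eq_bigr => x _ do rewrite ffunE /= mulr_sumr.
rewrite exchange_big /= [RHS](eq_bigr (fun y => \sum_x
   u (g, x) * v ((g ^ x)%g, (x^-1 * y)%g) * w ((g ^ y)%g, (y^-1 * z)%g))); last first.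
  by move=> y _; rewrite ffunE /= mulr_suml.
rewrite [RHS]exchange_big /= exchange_big /=; apply: eq_bigr => x _.
rewrite [RHS](reindex_inj (mulgI x)) /=; apply: eq_bigr => y _.
by rewrite mulKg conjgM invMg -mulgA mulrA.
Qed.

Lemma dbl_mul1l : left_id dbl_one dbl_mul.
Proof.
move=> u; apply/ffunP=> -[g z]; rewrite ffunE /=.
rewrite (bigD1 1%g) //= big1 ?addr0 => [|x /negPf x1]; rewrite ffunE /=.
  by rewrite eqxx mul1r conjg1 invg1 mul1g.
by rewrite x1 mul0r.
Qed.

Lemma dbl_mul1r : right_id dbl_one dbl_mul.
Proof.
move=> u; apply/ffunP=> -[g z]; rewrite ffunE /=.
rewrite (bigD1 z) //= big1 ?addr0 => [|x /negPf xz]; rewrite ffunE /=.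
  by rewrite mulVg eqxx mulr1.
by rewrite -eq_mulVg1 xz mulr0.
Qed.

Lemma dbl_mulDl : left_distributive dbl_mul +%R.
Proof.
move=> u v w; apply/ffunP=> -[g z]; rewrite !ffunE -big_split /=.
by apply: eq_bigr => x _; rewrite ffunE mulrDl.
Qed.

Lemma dbl_mulDr : right_distributive dbl_mul +%R.
Proof.
move=> u v w; apply/ffunP=> -[g z]; rewrite !ffunE -big_split /=.
by apply: eq_bigr => x _; rewrite ffunE mulrDr.
Qed.

Lemma dbl_one_neq0 : dbl_one != 0.
Proof.
apply/eqP => /ffunP/(_ (1%g, 1%g)); rewrite !ffunE eqxx => /eqP.
by rewrite oner_eq0.
Qed.

HB.instance Definition _ := GRing.Zmodule_isNzRing.Build DG
  dbl_mulA dbl_mul1l dbl_mul1r dbl_mulDl dbl_mulDr dbl_one_neq0.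

Lemma dbl_scaleAl (c : k) (u v : DG) : c *: (u * v) = (c *: u) * v.
Proof.
apply/ffunP=> -[g z]; rewrite !ffunE scaler_sumr /=.
by apply: eq_bigr => x _; rewrite ffunE -scalerAl.
Qed.

HB.instance Definition _ := GRing.Lmodule_isLalgebra.Build k DG dbl_scaleAl.

Lemma dbl_scaleAr (c : k) (u v : DG) : c *: (u * v) = u * (c *: v).
Proof.
apply/ffunP=> -[g z]; rewrite !ffunE scaler_sumr /=.
by apply: eq_bigr => x _; rewrite ffunE -scalerAr.
Qed.

HB.instance Definition _ := GRing.Lalgebra_isAlgebra.Build k DG dbl_scaleAr.

Definition dbl_basis (g x : gT) : DG := [ffun p => (p == (g, x))%:R].

(* D(G) (x) D(G) is encoded by coordinates in the basis of tensors of basis    *)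
(* elements.                                                                   *)
Definition dbl_comul (u : DG) : {ffun (gT * gT) * (gT * gT) -> k} :=
  [ffun pq => if pq.1.2 == pq.2.2 then u ((pq.1.1 * pq.2.1)%g, pq.1.2) else 0].

Definition dbl_counit (u : DG) : k := \sum_(x : gT) u (1%g, x).

Definition dbl_antipode (u : DG) : DG :=
  [ffun p => u ((p.1^-1 ^ p.2)%g, (p.2^-1)%g)].

Lemma dbl_basisM g x h y :
  dbl_basis g x * dbl_basis h y
    = if (g ^ x)%g == h then dbl_basis g (x * y)%g else 0.
Proof.
apply/ffunP=> -[a z]; rewrite ffunE /= (bigD1 x) //= big1 ?addr0; last first.
  by move=> t /negPf tx; rewrite ffunE xpair_eqE tx andbF mul0r.
rewrite !ffunE !xpair_eqE eqxx andbT.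
have -> : (x^-1 * z == y)%g = (z == x * y)%g.
  by rewrite -(inj_eq (mulgI x)) mulKVg.
case: (eqVneq a g) => [->|ag]; last first.
  by rewrite mul0r; case: ifP => _; rewrite !ffunE // xpair_eqE (negPf ag).
by rewrite mul1r; case: eqP => _; rewrite !ffunE // xpair_eqE eqxx.
Qed.

Lemma dbl_oneE : 1 = \sum_(g : gT) dbl_basis g 1%g.
Proof.
apply/ffunP=> -[a z]; rewrite sum_ffunE ffunE /= (bigD1 a) //= big1 ?addr0.
  by rewrite ffunE xpair_eqE eqxx.
by move=> g ga; rewrite ffunE xpair_eqE eq_sym (negPf ga).
Qed.

Lemma dbl_expand (u : DG) : u = \sum_p u p *: dbl_basis p.1 p.2.
Proof.
apply/ffunP=> q; rewrite sum_ffunE (bigD1 q) //= big1 ?addr0; last first.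
  by move=> p pq; rewrite !ffunE -surjective_pairing eq_sym (negPf pq) scaler0.
by rewrite !ffunE -surjective_pairing eqxx; rewrite [_ *: _]mulr1.
Qed.

Lemma dbl_monoid_morphism n (f : {linear DG -> 'M[k]_n}) :
  (forall g x h y, f (dbl_basis g x) *m f (dbl_basis h y)
     = if (g ^ x)%g == h then f (dbl_basis g (x * y)%g) else 0) ->
  \sum_g f (dbl_basis g 1%g) = 1%:M -> monoid_morphism f.
Proof.
move=> fM f1; split=> [|u v]; first by rewrite dbl_oneE linear_sum f1.
rewrite [u in LHS]dbl_expand [v in LHS]dbl_expand mulr_suml linear_sum.
rewrite [u in RHS]dbl_expand [v in RHS]dbl_expand !linear_sum /=.
rewrite [RHS]mulmx_suml; apply: eq_bigr => -[g x] _ /=.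
rewrite mulr_sumr linear_sum [RHS]mulmx_sumr; apply: eq_bigr => -[h y] _ /=.
rewrite -scalerAr -scalerAl dbl_basisM !linearZ /=.
rewrite -scalemxAl fM.
by case: ifP => // _; rewrite linear0.
Qed.

(* A finite-dimensional D(G)-module is k^n with u acting on column vectors by  *)
(* the matrix [dmod_act u].                                                    *)
Record dmod := DMod {
  dmod_dim : nat;
  dmod_act :> {lrmorphism DG -> 'M[k]_dmod_dim}
}.

Definition dhom (V W : dmod) (T : 'M[k]_(dmod_dim W, dmod_dim V)) : Prop :=
  forall u, T *m V u = W u *m T.

Definition diso (V W : dmod) : Prop :=
  exists (T : 'M_(dmod_dim W, dmod_dim V)) (S : 'M_(dmod_dim V, dmod_dim W)),
    [/\ dhom T, dhom S, T *m S = 1%:M & S *m T = 1%:M].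

Definition dsimple (V : dmod) : Prop :=
  (0 < dmod_dim V)%N /\
  forall U : {vspace 'cV[k]_(dmod_dim V)},
    (forall u v, v \in U -> V u *m v \in U) -> U = 0%VS \/ U = fullv.

Definition dzero_act (u : DG) : 'M[k]_0 := 0.

Lemma dzero_linear : linear dzero_act.
Proof. by move=> c u v; rewrite /dzero_act scaler0 addr0. Qed.

HB.instance Definition _ := GRing.isLinear.Build k DG 'M[k]_0 _ dzero_act
  dzero_linear.

Lemma dzero_monoid : monoid_morphism dzero_act.
Proof. by split=> [|u v]; apply/matrixP=> -[]. Qed.

HB.instance Definition _ := GRing.isMonoidMorphism.Build DG 'M[k]_0 dzero_act
  dzero_monoid.

Definition dzero : dmod := DMod dzero_act.

Section DirectSum.

Variables V W : dmod.
Let n := (dmod_dim V + dmod_dim W)%N.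

Definition dadd_act (u : DG) : 'M[k]_n := block_mx (V u) 0 0 (W u).

Lemma dadd_linear : linear dadd_act.
Proof.
move=> c u v; rewrite /dadd_act !linearP.
by rewrite scale_block_mx add_block_mx !scaler0 !addr0.
Qed.

HB.instance Definition _ := GRing.isLinear.Build k DG 'M[k]_n _ dadd_act
  dadd_linear.

Lemma dadd_monoid : monoid_morphism dadd_act.
Proof.
rewrite /dadd_act; split=> [|u v].
  by rewrite !rmorph1 -scalar_mx_block.
rewrite !rmorphM /= [RHS]mulmx_block.
by rewrite !mulmx0 !mul0mx !addr0 !add0r.
Qed.

HB.instance Definition _ := GRing.isMonoidMorphism.Build DG 'M[k]_n dadd_act
  dadd_monoid.

Definition dadd : dmod := DMod dadd_act.

End DirectSum.

Definition dunit_act (u : DG) : 'M[k]_1 := (dbl_counit u)%:M.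

Lemma dbl_counitE g x : dbl_counit (dbl_basis g x) = (g == 1%g)%:R.
Proof.
rewrite /dbl_counit (bigD1 x) //= big1 ?addr0 => [|y yx]; rewrite ffunE.
  by rewrite xpair_eqE eqxx andbT eq_sym.
by rewrite xpair_eqE (negPf yx) andbF.
Qed.

Lemma dunit_linear : linear dunit_act.
Proof.
move=> c u v; rewrite /dunit_act /dbl_counit scale_scalar_mx -raddfD mulr_sumr.
by rewrite -big_split; congr _%:M; apply: eq_bigr => x _; rewrite !ffunE.
Qed.

HB.instance Definition _ := GRing.isLinear.Build k DG 'M[k]_1 _ dunit_act
  dunit_linear.

Lemma dunit_monoid : monoid_morphism dunit_act.
Proof.
apply: dbl_monoid_morphism => [g x h y|] /=; rewrite /dunit_act.
  rewrite -scalar_mxM !dbl_counitE; case: (eqVneq g 1%g) => [->|_].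
    by rewrite conj1g mul1r eq_sym; case: eqP => // _; rewrite raddf0.
  by rewrite mul0r !raddf0 if_same.
rewrite (bigD1 1%g) //= big1 ?addr0 => [|g g1]; rewrite dbl_counitE ?eqxx //.
by rewrite (negPf g1) raddf0.
Qed.

HB.instance Definition _ := GRing.isMonoidMorphism.Build DG 'M[k]_1 dunit_act
  dunit_monoid.

Definition dunit : dmod := DMod dunit_act.

Section Tensor.

Variables V W : dmod.
Let n := (dmod_dim V * dmod_dim W)%N.

Definition dtens_act (u : DG) : 'M[k]_n :=
  \sum_p \sum_q dbl_comul u (p, q) *:
     tensmx (V (dbl_basis p.1 p.2)) (W (dbl_basis q.1 q.2)).

Lemma dtens_linear : linear dtens_act.
Proof.
move=> c u v; rewrite /dtens_act scaler_sumr -big_split; apply: eq_bigr => p _.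
rewrite scaler_sumr -big_split; apply: eq_bigr => q _ /=.
rewrite scalerA -scalerDl; congr (_ *: _); rewrite !ffunE.
by case: ifP; rewrite ?mulr0 ?addr0.
Qed.

HB.instance Definition _ := GRing.isLinear.Build k DG 'M[k]_n _ dtens_act
  dtens_linear.

Lemma dtens_actE g x : dtens_act (dbl_basis g x) =
  \sum_s tensmx (V (dbl_basis s x)) (W (dbl_basis (s^-1 * g)%g x)).
Proof.
transitivity (\sum_s \sum_y \sum_q dbl_comul (dbl_basis g x) ((s, y), q) *:
    tensmx (V (dbl_basis s y)) (W (dbl_basis q.1 q.2))).
  by rewrite pair_bigA; apply: eq_bigr => -[s y] _.
apply: eq_bigr => s _; rewrite (bigD1 x) //= [X in _ + X]big1 ?addr0.
  rewrite (bigD1 ((s^-1 * g)%g, x)) //= [X in _ + X]big1 ?addr0.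
    by rewrite !ffunE /= !eqxx mulKVg eqxx scale1r.
  move=> -[t y] /=; rewrite !ffunE /= xpair_eqE => ty.
  case: eqP => [xy|]; last by rewrite scale0r.
  move: ty; rewrite xy eqxx andbT xpair_eqE eqxx andbT.
  by rewrite -(inj_eq (mulgI s)) mulKVg => /negPf->; rewrite scale0r.
move=> y yx; apply: big1 => -[t z] _; rewrite !ffunE /= xpair_eqE (negPf yx).
by rewrite andbF; case: ifP; rewrite scale0r.
Qed.

Lemma dtens_monoid : monoid_morphism dtens_act.
Proof.
have actM (X : dmod) g x h y : X (dbl_basis g x) *m X (dbl_basis h y) =
    if (g ^ x)%g == h then X (dbl_basis g (x * y)%g) else 0.
  rewrite -[LHS](rmorphM (dmod_act X)) dbl_basisM.
  by case: ifP => // _; rewrite raddf0.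
apply: dbl_monoid_morphism => [g x h y|] /=.
  rewrite !dtens_actE mulmx_suml.
  under eq_bigr => s _.
    rewrite mulmx_sumr (bigD1 (s ^ x)%g) //= big1 ?addr0; last first.
      move=> t ts; rewrite tensmx_mul actM eq_sym (negPf ts).
      by apply/matrixP=> i j; rewrite !mxE mul0r.
    rewrite tensmx_mul !actM eqxx conjMg conjVg (inj_eq (mulgI _)).
    over.
  case: eqP => [_|_] /=; first by [].
  by apply: big1 => s _; apply/matrixP=> i j; rewrite !mxE mulr0.
under eq_bigr => g _ do rewrite dtens_actE.
rewrite exchange_big /=.
under eq_bigr => s _.
  rewrite (reindex_inj (mulgI s)) /=.
  under eq_bigr => g _ do rewrite mulKg.
  over.
have tensE (A : gT -> 'M[k]_(dmod_dim V)) (B : gT -> 'M[k]_(dmod_dim W)) :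
    \sum_s \sum_g tensmx (A s) (B g)
    = tensmx (\sum_s A s) (\sum_g B g).
  apply/matrixP=> i j; rewrite !mxE !summxE big_distrl /=.
  apply: eq_bigr => s _; rewrite summxE big_distrr /=.
  by apply: eq_bigr => g _; rewrite mxE.
rewrite tensE -!linear_sum /= -dbl_oneE !rmorph1.
by apply/matrixP=> i j; case: (mxtens_indexP i) => i1 i2;
  case: (mxtens_indexP j) => j1 j2; rewrite !mxE !mxtens_indexK /=
    (inj_eq (can_inj (@mxtens_indexK _ _))) xpair_eqE -natrM mulnb.
Qed.

HB.instance Definition _ := GRing.isMonoidMorphism.Build DG 'M[k]_n dtens_act
  dtens_monoid.

Definition dtens : dmod := DMod dtens_act.

End Tensor.

Section Dual.

Variable V : dmod.
Let n := dmod_dim V.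

Definition ddual_act (u : DG) : 'M[k]_n := (V (dbl_antipode u))^T.

Lemma dbl_antipodeE g x :
  dbl_antipode (dbl_basis g x) = dbl_basis ((g^-1)^ x)%g x^-1%g.
Proof.
apply/ffunP=> -[h y]; rewrite !ffunE /= !xpair_eqE.
congr (nat_of_bool _)%:R; rewrite (can2_eq invgK invgK) andbC [RHS]andbC.
case: eqP => //= ->; rewrite -(inj_eq (conjg_inj x)) -conjgM mulVg conjg1.
by rewrite conjVg -(inj_eq invg_inj) invgK.
Qed.

Lemma ddual_linear : linear ddual_act.
Proof.
move=> c u v; rewrite /ddual_act -linearP /=; congr (_^T).
by rewrite -linearP; congr (V _); apply/ffunP=> p; rewrite !ffunE.
Qed.

HB.instance Definition _ := GRing.isLinear.Build k DG 'M[k]_n _ ddual_act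
  ddual_linear.

Lemma ddual_monoid : monoid_morphism ddual_act.
Proof.
apply: dbl_monoid_morphism => [g x h y|] /=; rewrite /ddual_act.
  rewrite -trmx_mul !dbl_antipodeE -[_ *m _]rmorphM dbl_basisM.
  rewrite -conjgM mulgV conjg1 (conjVg g) (inj_eq invg_inj) eq_sym.
  have [<-|_] := eqVneq; last by rewrite raddf0 trmx0.
  by rewrite (invMg x y) conjgM (conjVg g x).
rewrite -[RHS]trmx1 -linear_sum /=; congr (_^T).
rewrite -linear_sum /= (reindex_inj invg_inj) /=.
under eq_bigr => g _ do rewrite dbl_antipodeE invgK conjg1 invg1.
by rewrite -dbl_oneE rmorph1.
Qed.

HB.instance Definition _ := GRing.isMonoidMorphism.Build DG 'M[k]_n ddual_act
  ddual_monoid.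

Definition ddual : dmod := DMod ddual_act.

End Dual.

(* The empty direct sum is [dzero]; W is reached in [fusion_summand] through  *)
(* [fusion_iso], since V + W and W + V are isomorphic.                         *)
Record fusion_subcategory (D : set dmod) : Prop := FusionSubcategory {
  fusion_iso : forall V W, diso V W -> D V -> D W;
  fusion_unit : D dunit;
  fusion_zero : D dzero;
  fusion_add : forall V W, D V -> D W -> D (dadd V W);
  fusion_summand : forall V W, D (dadd V W) -> D V;
  fusion_tens : forall V W, D V -> D W -> D (dtens V W);
  fusion_dual : forall V, D V -> D (ddual V)
}.

(* Irreducible k-characters of A, extended by 0 outside A.                     *)
Definition irr_character (A : {group gT}) (chi : gT -> k) : Prop :=
  exists n (rG : mx_representation k A n),
    mx_irreducible rG /\ forall x, chi x = if x \in A then \tr (rG x) else 0.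

(* The fiber over g of the equivariant bundle V is e_g V.  For x in C_G(a),    *)
(* e_a x acts as x on the fiber over a and as 0 on the other fibers, so its    *)
(* trace on V is the character of the fiber over a at x.                       *)
Definition is_bundle (a : gT) (chi : gT -> k) (V : dmod) : Prop :=
  [/\ dsimple V,
      forall g, (V (dbl_basis g 1%g) != 0) = (g \in (a ^: [set: gT])%g)
    & forall x, x \in 'C[a]%g -> \tr (V (dbl_basis a x)) = chi x].

Variable R : {set gT}.

Definition Gamma (a : gT) (chi : gT -> k) : Prop :=
  a \in R /\ irr_character 'C[a]%G chi.

Definition in_Gamma (D : set dmod) (a : gT) (chi : gT -> k) : Prop :=
  Gamma a chi /\ exists2 V, D V & is_bundle a chi V.

Definition supp_of (D : set dmod) : {set gT} :=
  [set y | `[< exists a chi g, in_Gamma D a chi /\ y = (g * a * g^-1)%g >]]%SET.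

Definition ker_of (D : set dmod) : {set gT} :=
  [set h | `[< forall chi, in_Gamma D 1%g chi -> chi h = chi 1%g >]]%SET.

(* A map B : K x H -> k^* is encoded by its extension by 0 to G x G.  [xget]   *)
(* selects the common value of the displayed quotients.                        *)
Definition bichar_of (D : set dmod) (y h : gT) : k :=
  if (y \in supp_of D) && (h \in ker_of D) then
    xget 0 [set v | exists a chi g, [/\ in_Gamma D a chi,
      y = (g^-1 * a * g)%g & v = chi (g * h * g^-1)%g / chi 1%g]]%classic
  else 0.

Definition centralizing_triple (K H : {set gT}) (B : gT -> gT -> k) : Prop :=
  [/\ group_set K /\ (K <| [set: gT])%g,
      group_set H /\ (H <| [set: gT])%g,
      {in K & H, forall y h, commute y h},
      forall y h, (B y h != 0) = (y \in K) && (h \in H)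
    & [/\ {in K & K & H, forall y z h, B (y * z)%g h = B y h * B z h},
          {in K & H & H, forall y h l, B y (h * l)%g = B y h * B y l}
        & forall x, {in K & H, forall y h,
            B (x * y * x^-1)%g (x * h * x^-1)%g = B y h}]].

Definition S_of (K H : {set gT}) (B : gT -> gT -> k) : set dmod :=
  [set V | exists n (F : 'I_n -> dmod),
     diso V (\big[dadd/dzero]_(i < n) F i) /\
     forall i, exists a chi,
       [/\ Gamma a chi, a \in K, is_bundle a chi (F i)
         & {in H, forall h, chi h = B a h * chi 1%g}]]%classic.

End Double.

(* Main.v *)
(* An object V of Rep(D(G)) lies in S(K,H,B) iff e_g h acts on V as B(g,h) e_g  *)
(* for all g in G and h in H, where B is extended by 0 outside K x H: for a     *)
(* bundle, the average of B(a,h)^-1 e_a h over H is an idempotent of trace      *)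
(* chi(1), hence is the whole of e_a.  The conditions of a fusion subcategory   *)
(* are immediate in this form, and cutting the regular module by the central    *)
(* idempotent attached to (K,H,B) shows that the triple can be recovered.       *)
(*                                                                              *)
(* Conversely, let D be a fusion subcategory and let A_g be the space of the    *)
(* functions x |-> l(e_g x v), for the matrix coefficients (l,v) of objects of  *)
(* D.  Tensor products give A_g A_h <= A_gh, and A_1 is a translation-invariant *)
(* unital algebra of functions on G, hence consists of the functions on G/H     *)
(* for a normal subgroup H.  If A_g <> 0 then A_(g^-1) <> 0 by duality, and     *)
(* multiplying by an element of A_(g^-1) shows that A_g consists exactly of the *)
(* functions with f(hx) = B(g,h) f(x).  So every object W of S(K,H,B) has its   *)
(* coefficients among those of D, and averaging over the separability           *)
(* idempotent of D(G) turns this into a splitting of W off an object of D.      *)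

From HB Require Import structures.
Require Import Defs.
From mathcomp Require Import all_boot all_order all_algebra all_fingroup.
From mathcomp Require Import all_character mxtens.
From mathcomp Require Import boolp classical_sets functions.

Import GRing.Theory.
Local Open Scope ring_scope.

(** The condition defining S(K,H,B) is stated on simple bundles; [S_of_isotypic] turns it into the
    linear condition [isotypic] on arbitrary modules, which sums, summands, tensor products and
    duals visibly preserve ([isotypic_fusion]). There are enough isotypic objects
    ([isotypic_generator]) to read the triple back: [supp_of_isotypic], [ker_of_isotypic],
    [bichar_of_isotypic].

    The substance is [fusion_triple]: every fusion subcategory D is of this form. D is replaced by
    its matrix coefficients, functions on G with a degree in G. Those of degree 1 form an algebra,
    which by interpolation contains the indicator of [fusion_ker] ([coef_indicator]). Multiplying
    degree h by degree h^-1 shows that this kernel acts by a scalar on each e_h, which yields the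
    triple ([fusion_isotypic]). Conversely, convolution with one coefficient of degree h supported
    on the kernel reproduces every isotypic coefficient of degree h ([isotypic_mem]), and a module
    all of whose coefficients come from D is a summand of an object of D ([coef_mem]).

    Characteristic zero enters through division by |G| and |H|, and through the equality of trace
    and rank for idempotents. *)

Lemma eq_mx_on_columns [R : nzRingType] [m n : nat] (A B : 'M[R]_(m, n)) :
  (forall v : 'cV_n, A *m v = B *m v) -> A = B.
Proof.
move=> AB; apply/trmx_inj/row_matrixP=> j.
by rewrite -!tr_col !colE AB.
Qed.

(** Cancelling the injective [col_base E] on the left and the surjective [row_base E] on the right
    in [E *m E = E] leaves [R *m C = 1%:M]. *)
Lemma idempotent_factor [F : fieldType] [n : nat] (E : 'M[F]_n) :
  E *m E = E -> exists r (C : 'M_(n, r)) (R : 'M_(r, n)),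
  [/\ R *m C = 1%:M, C *m R = E & r = \rank E].
Proof.
move=> EE; have CR := mulmx_base E.
exists (\rank E), (col_base E), (row_base E); split=> //.
have /(_ _ _ 1%:M) := row_full_inj (col_base_full E); apply.
have /(_ _ _ (col_base E *m 1%:M)) := row_free_inj (row_base_free E); apply.
by rewrite mulmx1 mulmxA CR -mulmxA CR EE.
Qed.

(** * Modules over the double *)

Section Modules.

Set Implicit Arguments.
Unset Strict Implicit.

Variables (k : fieldType) (gT : finGroupType).
Implicit Types (V W X Y : dmod k gT) (g h x y : gT).

Local Notation eb := (dbl_basis k).
Local Notation dim := dmod_dim.
Local Notation DG := (Defs.double k gT).

Lemma dmod_basisM V g x h y : V (eb g x) *m V (eb h y) =
  if (g ^ x)%g == h then V (eb g (x * y)%g) else 0.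
Proof.
rewrite -[LHS](rmorphM (dmod_act V)) dbl_basisM.
by case: ifP => // _; rewrite raddf0.
Qed.

Lemma dmod_basisMJ V g x y :
  V (eb g x) *m V (eb (g ^ x)%g y) = V (eb g (x * y)%g).
Proof. by rewrite dmod_basisM eqxx. Qed.

Lemma dmod_basis1M V g x : V (eb g 1%g) *m V (eb g x) = V (eb g x).
Proof. by rewrite dmod_basisM conjg1 eqxx mul1g. Qed.

Lemma dmod_basisM1 V g x : V (eb g x) *m V (eb (g ^ x)%g 1%g) = V (eb g x).
Proof. by rewrite dmod_basisMJ mulg1. Qed.

Lemma dmod_sum_basis1 V : \sum_g V (eb g 1%g) = 1%:M.
Proof. by rewrite -linear_sum -dbl_oneE rmorph1. Qed.

Lemma dmod_basis_eq0 V g x : V (eb g 1%g) = 0 -> V (eb g x) = 0.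
Proof. by move=> V0; rewrite -dmod_basis1M V0 mul0mx. Qed.

(** Used to carry a relation on the fiber over [g] to the fibers over all conjugates of [g]. *)
Lemma dmod_basisJ V g x y :
  V (eb (g ^ x)%g (y ^ x)%g) = V (eb (g ^ x)%g x^-1%g) *m V (eb g y) *m
    V (eb (g ^ y)%g x).
Proof.
rewrite dmod_basisM -conjgM mulgV conjg1 eqxx dmod_basisM.
by rewrite !conjgM conjgK eqxx [in LHS](conjgE y x) mulgA.
Qed.

Lemma dmod_basisJ_eq0 V g x : V (eb (g ^ x)%g 1%g) = 0 <-> V (eb g 1%g) = 0.
Proof.
have J h y : V (eb h 1%g) = 0 -> V (eb (h ^ y)%g 1%g) = 0.
  by move=> V0; rewrite -(conj1g y) dmod_basisJ V0 mulmx0 mul0mx.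
by split=> [/(J _ x^-1%g)|/J//]; rewrite conjgK.
Qed.

Lemma dhomP V W (T : 'M_(dim W, dim V)) :
  (forall g x, T *m V (eb g x) = W (eb g x) *m T) -> dhom T.
Proof.
move=> hT u; rewrite (dbl_expand u) !linear_sum mulmx_suml.
apply: eq_bigr => p _.
by rewrite !linearZ -scalemxAl /= hT.
Qed.

Lemma dhom_mul V W X (S : 'M_(dim X, dim W)) (T : 'M_(dim W, dim V)) :
  dhom S -> dhom T -> dhom (S *m T).
Proof. by move=> hS hT u; rewrite -mulmxA hT !mulmxA hS. Qed.

Lemma dhom1 V : @dhom k gT V V 1%:M.
Proof. by move=> u; rewrite mul1mx mulmx1. Qed.

Lemma diso_refl V : diso V V.
Proof. by exists 1%:M, 1%:M; rewrite mulmx1; split=> //; apply: dhom1. Qed.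

Lemma diso_sym V W : diso V W -> diso W V.
Proof. by case=> T [S [? ? ? ?]]; exists S, T. Qed.

Lemma diso_trans V W X : diso V W -> diso W X -> diso V X.
Proof.
case=> T [S [hT hS TS ST]] [T' [S' [hT' hS' TS' ST']]].
exists (T' *m T), (S *m S'); split; try exact: dhom_mul.
  by rewrite mulmxA -(mulmxA T') TS mulmx1.
by rewrite mulmxA -(mulmxA S) ST' mulmx1.
Qed.

Lemma diso_dadd V V' W W' :
  diso V V' -> diso W W' -> diso (dadd V W) (dadd V' W').
Proof.
case=> T [S [hT hS TS ST]] [T' [S' [hT' hS' TS' ST']]].
exists (block_mx T 0 0 T'), (block_mx S 0 0 S'); split.
- move=> u; rewrite !mulmx_block !mulmx0 !mul0mx !addr0 !add0r.
  by rewrite hT hT'.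
- move=> u; rewrite !mulmx_block !mulmx0 !mul0mx !addr0 !add0r.
  by rewrite hS hS'.
- rewrite mulmx_block !mulmx0 !mul0mx !addr0 !add0r TS TS'.
  by rewrite -scalar_mx_block.
rewrite mulmx_block !mulmx0 !mul0mx !addr0 !add0r ST ST'.
by rewrite -scalar_mx_block.
Qed.

Lemma diso_dim V W : diso V W -> dim V = dim W.
Proof.
case=> T [S [_ _ /mulmx1_min TS /mulmx1_min ST]].
by apply/eqP; rewrite eqn_leq ST TS.
Qed.

Lemma diso_trace V W u : diso V W -> \tr (V u) = \tr (W u).
Proof.
case=> T [S [hT hS TS ST]].
by rewrite -[V u]mulmx1 -ST mulmxA -hS -mulmxA mxtrace_mulC -mulmxA TS mulmx1.
Qed.

Lemma bigdadd_trace n (F : 'I_n -> dmod k gT) u :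
  \tr ((\big[@dadd k gT/dzero k gT]_(i < n) F i) u) = \sum_(i < n) \tr (F i u).
Proof.
elim: n F => [|n IHn] F; first by rewrite !big_ord0 thinmx0 mxtrace0.
by rewrite !big_ord_recl -IHn; apply: mxtrace_block.
Qed.

Lemma factor_dmod X r (C : 'M_(dim X, r)) (R : 'M_(r, dim X)) :
  R *m C = 1%:M -> dhom (V := X) (W := X) (C *m R) ->
  exists2 act : {lrmorphism DG -> 'M[k]_r},
    dhom (V := DMod act) (W := X) C & dhom (V := X) (W := DMod act) R.
Proof.
move=> RC hE; pose act u := R *m X u *m C.
have actC u : C *m act u = X u *m C.
  by rewrite !mulmxA hE -!mulmxA RC mulmx1.
have actR u : R *m X u = act u *m R.
  by rewrite -!mulmxA -hE !mulmxA RC mul1mx.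
have actL : linear act.
  by move=> c u v; rewrite /act linearP mulmxDr mulmxDl -scalemxAr -scalemxAl.
have actM : monoid_morphism act.
  split=> [|u v]; first by rewrite /act rmorph1 mulmx1.
  rewrite -[RHS]/(act u *m act v) {1}/act rmorphM -[_ * _]/(X u *m X v).
  by rewrite mulmxA actR -(mulmxA (act u)) -(mulmxA (act u)).
pose actH := GRing.isLinear.Build k DG 'M[k]_r _ act actL.
pose actMH := GRing.isMonoidMorphism.Build DG 'M[k]_r act actM.
pose actLR : {lrmorphism DG -> 'M[k]_r} := HB.pack act actH actMH.
by exists actLR.
Qed.

Lemma split_idempotent X (E : 'M_(dim X)) :
  dhom (V := X) (W := X) E -> E *m E = E ->
  exists W (C : 'M_(dim X, dim W)) (R : 'M_(dim W, dim X)),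
  [/\ dhom C, dhom R, R *m C = 1%:M, C *m R = E & dim W = \rank E].
Proof.
move=> hE EE; have [r [C [R [RC CR rE]]]] := idempotent_factor _ EE.
have [|act hC hR] := factor_dmod RC; first by rewrite CR.
by exists (DMod act), C, R.
Qed.

(** A direct summand without a chosen complement, so that the relation composes easily;
    [retract_summand] supplies the complement as the image of the idempotent 1 - ST. *)
Definition retract W X := exists (S : 'M_(dim X, dim W)) (T : 'M_(dim W, dim X)),
  [/\ dhom S, dhom T & T *m S = 1%:M].

Lemma retract_refl X : retract X X.
Proof. by exists 1%:M, 1%:M; rewrite mulmx1; split=> //; apply: dhom1. Qed.

Lemma retract_trans V W X : retract V W -> retract W X -> retract V X.
Proof.
case=> S [T [hS hT TS]] [S' [T' [hS' hT' TS']]].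
exists (S' *m S), (T *m T'); split; try exact: dhom_mul.
by rewrite mulmxA -(mulmxA T) TS' mulmx1.
Qed.

Lemma retract_summand W X : retract W X ->
  exists2 W', diso X (dadd W W') & retract W' X.
Proof.
case=> S [T [hS hT TS]]; pose E := 1%:M - S *m T.
have hST := dhom_mul hS hT.
have hE : dhom (V := X) (W := X) E.
  by move=> u; rewrite mulmxBl mulmxBr mul1mx mulmx1 hST.
have ES : E *m S = 0 by rewrite mulmxBl mul1mx -mulmxA TS mulmx1 subrr.
have TE : T *m E = 0 by rewrite mulmxBr mulmx1 mulmxA TS mul1mx subrr.
have EE : E *m E = E by rewrite {2}/E mulmxBr mulmx1 mulmxA ES mul0mx subr0.
have [W' [C [R [hC hR RC CR dW']]]] := split_idempotent hE EE.
have RS : R *m S = 0 by rewrite -[R]mul1mx -RC -!mulmxA (mulmxA C) CR ES mulmx0.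
have TC : T *m C = 0 by rewrite -[C]mulmx1 -RC !mulmxA -(mulmxA T) CR TE mul0mx.
exists W'; last by exists C, R.
exists (col_mx T R), (row_mx S C); split.
- by move=> u; rewrite mul_col_mx [RHS]mul_block_col !mul0mx addr0 add0r hT hR.
- by move=> u; rewrite mul_mx_row [LHS]mul_row_block !mulmx0 addr0 add0r hS hC.
- by rewrite mul_col_row TS TC RS RC -scalar_mx_block.
by rewrite mul_row_col CR addrC subrK.
Qed.

Lemma dadd_retract V W : retract V (dadd V W).
Proof.
exists (col_mx 1%:M 0 : 'M_(dim (dadd V W), dim V)).
exists (row_mx 1%:M 0 : 'M_(dim V, dim (dadd V W))); split.
- move=> u; rewrite mul_col_mx [RHS]mul_block_col.
  by rewrite !mul0mx !mulmx0 mul1mx mulmx1 !addr0.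
- move=> u; rewrite mul_mx_row [LHS]mul_row_block.
  by rewrite !mul0mx !mulmx0 mul1mx mulmx1 !addr0.
by rewrite mul_row_col mulmx1 mul0mx addr0.
Qed.

End Modules.

(** * Semisimplicity and simple objects *)

Section Semisimplicity.

Set Implicit Arguments.
Unset Strict Implicit.

Variables (k : fieldType) (gT : finGroupType).
Implicit Types (V W X Y : dmod k gT) (g h x y : gT).

Local Notation eb := (dbl_basis k).
Local Notation dim := dmod_dim.
Local Notation DG := (Defs.double k gT).

(* (1/|G|) \sum_(h, x) e_h x (x) e_(h^x) x^-1 is a separability idempotent.   *)
Definition avg V W (T : 'M_(dim W, dim V)) : 'M_(dim W, dim V) :=
  #|gT|%:R^-1 *: \sum_h \sum_x W (eb h x) *m T *m V (eb (h ^ x)%g x^-1%g).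

(** Multiplication by e_g y keeps only the terms h = g on one side and h = g^y on the other;
    replacing x by yx matches the two sums. *)
Lemma avg_hom V W (T : 'M_(dim W, dim V)) : dhom (avg T).
Proof.
apply: dhomP => g y; rewrite -scalemxAl -scalemxAr; congr (_ *: _).
rewrite mulmx_suml mulmx_sumr (bigD1 g) //= [X in _ + X]big1 ?addr0; last first.
  move=> h hg; rewrite mulmx_suml big1 // => x _.
  by rewrite -mulmxA dmod_basisM -conjgM mulgV conjg1 (negPf hg) mulmx0.
rewrite [RHS](bigD1 (g ^ y)%g) //= [X in _ + X]big1 ?addr0; last first.
  move=> h hg; rewrite mulmx_sumr big1 // => x _.
  by rewrite !mulmxA dmod_basisM eq_sym (negPf hg) !mul0mx.
rewrite mulmx_suml mulmx_sumr (reindex_inj (mulgI y)) /=.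
apply: eq_bigr => x _; rewrite -mulmxA dmod_basisM -conjgM mulgV conjg1 eqxx.
by rewrite !mulmxA dmod_basisMJ invMg mulgKV conjgM.
Qed.

Lemma avg_sum V W I (r : seq I) (T : I -> 'M_(dim W, dim V)) :
  avg (\sum_(i <- r) T i) = \sum_(i <- r) avg (T i).
Proof.
rewrite /avg -scaler_sumr; congr (_ *: _).
rewrite [RHS]exchange_big; apply: eq_bigr => h _.
rewrite [RHS]exchange_big; apply: eq_bigr => x _.
by rewrite mulmx_sumr mulmx_suml.
Qed.

Lemma avg_mulhom V W X (T : 'M_(dim X, dim W)) (S : 'M_(dim W, dim V)) :
  dhom S -> avg (T *m S) = avg T *m S.
Proof.
move=> hS; rewrite /avg -scalemxAl; congr (_ *: _).
rewrite mulmx_suml; apply: eq_bigr => h _.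
rewrite mulmx_suml; apply: eq_bigr => x _.
by rewrite -!mulmxA hS.
Qed.

Hypothesis pchar_k : [pchar k] =i pred0.

Lemma natr_cardG_neq0 (A : {group gT}) : #|A|%:R != 0 :> k.
Proof. by rewrite (iffLR (pcharf0P _)) // -lt0n cardG_gt0. Qed.

Lemma natr_card_neq0 : #|gT|%:R != 0 :> k.
Proof. by rewrite -cardsT; apply: (natr_cardG_neq0 [set: gT]%G). Qed.

(** Each h contributes |G| copies of e_h v, and the e_h sum to 1. With [T] the identity this is
    [avg1]; with [T] a linear projection onto a submodule it gives Maschke's theorem. *)
Lemma avg_fix V m (T : 'M_(dim V)) (v : 'M_(dim V, m)) :
  (forall g x, T *m (V (eb g x) *m v) = V (eb g x) *m v) ->
  avg (V := V) (W := V) T *m v = v.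
Proof.
move=> Tv; rewrite -scalemxAl mulmx_suml.
have sumE h : (\sum_x V (eb h x) *m T *m V (eb (h ^ x)%g x^-1%g)) *m v =
    #|gT|%:R *: (V (eb h 1%g) *m v).
  rewrite mulmx_suml (eq_bigr (fun=> V (eb h 1%g) *m v)) => [|x _].
    by rewrite sumr_const scaler_nat.
  by rewrite -!mulmxA Tv mulmxA dmod_basisMJ mulgV.
rewrite (eq_bigr _ (fun h _ => sumE h)) -scaler_sumr -mulmx_suml.
by rewrite dmod_sum_basis1 mul1mx scalerA mulVf ?scale1r // natr_card_neq0.
Qed.

Lemma avg1 V : avg (V := V) (W := V) 1%:M = 1%:M.
Proof. by rewrite -[LHS]mulmx1 avg_fix // => g x; rewrite mul1mx. Qed.

Lemma split_mono W X (S : 'M_(dim X, dim W)) (T : 'M_(dim W, dim X)) :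
  dhom S -> T *m S = 1%:M -> avg T *m S = 1%:M.
Proof. by move=> hS TS; rewrite -avg_mulhom // TS avg1. Qed.

Lemma submodule_projection X (U : {vspace 'cV[k]_(dim X)}) :
  (forall u v, v \in U -> X u *m v \in U) ->
  exists E : 'M_(dim X), [/\ dhom (V := X) (W := X) E,
    forall v, E *m v \in U & forall v, v \in U -> E *m v = v].
Proof.
move=> invU.
(* [lin1_mx] encodes maps of row vectors, whereas modules act on columns; hence the transposes. *)
pose f (r : 'rV[k]_(dim X)) := (projv U r^T)^T.
have fL : linear f.
  by move=> c r s; rewrite /f !linearP.
pose fH := GRing.isLinear.Build k 'rV[k]_(dim X) 'rV[k]_(dim X) _ f fL.
pose fLin : {linear 'rV[k]_(dim X) -> 'rV[k]_(dim X)} := HB.pack f fH.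
pose P := (lin1_mx fLin)^T.
have PE v : P *m v = projv U v.
  by rewrite -[LHS]trmxK trmx_mul trmxK mul_rV_lin1 /= /f !trmxK.
exists (avg (V := X) (W := X) P); split=> [|v|v vU]; first exact: avg_hom.
  rewrite -scalemxAl memvZ // mulmx_suml memv_suml // => h _.
  rewrite mulmx_suml memv_suml // => x _.
  by rewrite -!mulmxA invU // PE memv_proj.
by apply: avg_fix => g x; rewrite PE projv_id // invU.
Qed.

(** The kernel of [E] is a submodule, so it is 0 or everything; if it is 0, it contains v - Ev for
    every v. *)
Lemma dsimple_idempotent X (E : 'M_(dim X)) : dsimple X ->
  dhom (V := X) (W := X) E -> E *m E = E -> E != 0 -> E = 1%:M.
Proof.
case=> _ simX hE EE nzE; pose U := lker (linfun (mulmx E : 'cV_(dim X) -> _)).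
have UE v : (v \in U) = (E *m v == 0) by rewrite memv_ker lfunE.
have [u v|U0|UT] := simX U.
- by rewrite !UE mulmxA => /eqP Ev; rewrite hE -mulmxA Ev mulmx0.
- apply: eq_mx_on_columns => v; apply/eqP; rewrite -subr_eq0 -mulmxBl.
  by rewrite -memv0 -U0 UE mulmxA mulmxBr EE mulmx1 subrr mul0mx.
case/eqP: nzE; apply: eq_mx_on_columns => v; rewrite mul0mx.
by apply/eqP; rewrite -UE UT memvf.
Qed.

Lemma simple_retract X : (0 < dim X)%N -> exists2 V, dsimple V & retract V X.
Proof.
have [n] := ubnP (dim X); elim: n X => // n IHn X leXn X_gt0.
have [simX|nsimX] := pselect (dsimple X).
  by exists X => //; apply: retract_refl.
have [U [invU U0 UT]] : exists U : {vspace 'cV[k]_(dim X)},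
    [/\ forall u v, v \in U -> X u *m v \in U, U <> 0%VS & U <> fullv].
  apply: contrapT => noU; apply: nsimX; split=> // U invU.
  have [->|/eqP U0] := eqVneq U 0%VS; first by left.
  have [->|/eqP UT] := eqVneq U fullv; first by right.
  by case: noU; exists U.
have [E [hE EU UE]] := submodule_projection invU.
have EE : E *m E = E.
  by apply: eq_mx_on_columns => v; rewrite -mulmxA UE.
have [W [C [R [hC hR RC CR dW]]]] := split_idempotent hE EE.
have rWX : retract W X by exists C, R.
have W_gt0 : (0 < dim W)%N.
  rewrite dW lt0n mxrank_eq0; apply/eqP => E0; apply: U0; apply/eqP.
  rewrite -subv0; apply/subvP => v /UE <-; rewrite E0 mul0mx; exact: mem0v.
have W_lt : (dim W < dim X)%N.
  rewrite ltn_neqAle dW rank_leq_row andbT; apply/negP => fullE; apply: UT.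
  apply/vspaceP => v; rewrite memvf.
  suff E1 : E = 1%:M by rewrite -[v]mul1mx -E1 EU.
  have /(_ _ E 1%:M) := row_free_inj (fullE : row_free E); apply.
  by rewrite EE mul1mx.
have [V simV rVW] := IHn W (leq_trans W_lt leXn) W_gt0.
by exists V => //; apply: retract_trans rWX.
Qed.

(** A simple retract is split off and the dimension drops. The retractions are recorded because
    [isotypic] passes from [X] to its summands through them. *)
Lemma semisimple X : exists n (F : 'I_n -> dmod k gT),
  diso X (\big[@dadd k gT/dzero k gT]_(i < n) F i) /\
  forall i, dsimple (F i) /\ retract (F i) X.
Proof.
have [n] := ubnP (dim X); elim: n X => // n IHn X leXn.
have [X0|X_gt0] := posnP (dim X).
  exists 0%N, (fun=> dzero k gT); split=> [|[]//].
  rewrite big_ord0; exists 0, 0; split=> [u|u||].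
  - by apply/matrixP=> -[].
  - by apply/matrixP=> i [].
  - by apply/matrixP=> -[].
  by apply/matrixP=> i; have := ltn_ord i; rewrite [X in (_ < X)%N]X0.
have [V simV rVX] := simple_retract X_gt0.
have [W XVW rWX] := retract_summand rVX.
have [|m [F [WF simF]]] := IHn W.
  rewrite -ltnS; apply: leq_trans leXn; rewrite ltnS (diso_dim XVW) /=.
  by case: simV => V_gt0 _; rewrite -[X in (X < _)%N]add0n ltn_add2r.
exists m.+1, (fun i => if unlift ord0 i is Some j then F j else V); split.
  rewrite big_ord_recl unlift_none; apply: (diso_trans XVW).
  apply: diso_dadd; first exact: diso_refl.
  by under eq_bigr => i _ do rewrite liftK.
move=> i; case: unliftP => [j _|_] //.
by have [simFj rF] := simF j; split=> //; apply: retract_trans rWX.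
Qed.


Lemma simple_central X (E : 'M_(dim X)) : dsimple X ->
  (forall g x, E *m X (eb g x) = X (eb g x) *m E) -> E *m E = E -> E != 0 ->
  E = 1%:M.
Proof. by move=> simX /dhomP hE; apply: dsimple_idempotent. Qed.

Lemma sum_basis1M X (A : {set gT}) g x :
  (\sum_(h in A) X (eb h 1%g)) *m X (eb g x) = if g \in A then X (eb g x) else 0.
Proof.
rewrite mulmx_suml; under eq_bigr => h _ do rewrite dmod_basisM conjg1 mul1g.
case: ifP => gA; last first.
  by apply: big1 => h hA; case: eqP => // hg; rewrite -hg hA in gA.
rewrite (bigD1 g) //= eqxx big1 ?addr0 // => h /andP[_ /negPf->] //.
Qed.

Lemma sum_basis1Mr X (A : {set gT}) g x :
  X (eb g x) *m (\sum_(h in A) X (eb h 1%g)) =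
    if (g ^ x)%g \in A then X (eb g x) else 0.
Proof.
rewrite mulmx_sumr; under eq_bigr => h _ do rewrite dmod_basisM mulg1.
case: ifP => gA; last first.
  by apply: big1 => h hA; case: eqP => // hg; rewrite hg hA in gA.
rewrite (bigD1 (g ^ x)%g) //= eqxx big1 ?addr0 // => h /andP[_].
by rewrite eq_sym => /negPf->.
Qed.

(** The sum of the e_h over the conjugacy class of [a] is a central idempotent, hence acts as the
    identity once it is nonzero. *)
Lemma simple_support X a : dsimple X -> X (eb a 1%g) != 0 ->
  forall g, (X (eb g 1%g) != 0) = (g \in (a ^: [set: gT])%g).
Proof.
move=> simX Xa g; pose A := (a ^: [set: gT])%g.
pose E := \sum_(h in A) X (eb h 1%g).
have E1 : E = 1%:M.
  apply: simple_central => //.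
  - move=> h x; rewrite sum_basis1M sum_basis1Mr.
    by rewrite [(h ^ x)%g \in _]class_sym classGidl ?inE // class_sym.
  - by rewrite {2}/E mulmx_sumr; apply: eq_bigr => h hA; rewrite sum_basis1M hA.
  apply: contra_neq Xa => E0; have := sum_basis1M X A a 1%g.
  by rewrite -/E E0 mul0mx class_refl.
apply/idP/idP => [|/imsetP[x _ ->]].
  apply: contraR => /negPf gA; have := sum_basis1M X A g 1%g.
  by rewrite -/E E1 mul1mx gA => ->.
by apply: contra_neq Xa; apply: (iffLR (dmod_basisJ_eq0 _ _ _)).
Qed.

(** Matrix representations act on rows, so an invariant [U] is a space of functionals on the fiber
    e_a X. The vectors v such that [U] kills e_a y v for all y form a submodule [N] of [X]: if [N]
    is 0 then [U] is everything, and if [N] is [X] then [U] is 0. *)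
Lemma simple_fiber_irreducible X a : dsimple X -> X (eb a 1%g) != 0 ->
  exists2 chi, irr_character 'C[a]%G chi &
    forall x, x \in 'C[a]%g -> \tr (X (eb a x)) = chi x.
Proof.
move=> simX Xa.
have [n [C [P [PC CP rE]]]] := idempotent_factor _ (dmod_basis1M X a 1%g).
have Xa1 x : x \in 'C[a]%g -> X (eb a x) *m X (eb a 1%g) = X (eb a x).
  move=> /cent1P cax; rewrite -{2}(_ : a ^ x = a)%g ?dmod_basisM1 //.
  by rewrite conjgE -cax mulKg.
pose r x := P *m X (eb a x) *m C.
have rP : mx_repr 'C[a] r.
  split=> [|x y xa ya]; first by rewrite /r -CP !mulmxA PC mul1mx PC.
  rewrite /r !mulmxA -(mulmxA _ C P) CP -(mulmxA _ (X (eb a 1%g))) dmod_basis1M.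
  rewrite -(mulmxA P (X (eb a x))) -dmod_basisMJ.
  by move: xa => /cent1P cax; rewrite conjgE -cax mulKg.
exists (fun x => if x \in 'C[a]%g then \tr (r x) else 0); last first.
  by move=> x xa; rewrite xa /r -mulmxA mxtrace_mulC -mulmxA CP Xa1.
exists _, (MxRepresentation rP); split=> //.
apply/mx_irrP; split=> [|U /mxmoduleP modU nzU].
  by rewrite rE lt0n mxrank_eq0.
pose N := (\bigcap_y lker (linfun (mulmx (U *m P *m X (eb a y)) : 'cV_(dim X) -> _)))%VS.
have NP v : v \in N <-> forall y, U *m P *m X (eb a y) *m v = 0.
  rewrite memvE; split=> [/subv_bigcapP vN y|Nv].
    by apply/eqP; have := vN y isT; rewrite -memvE memv_ker lfunE.
  by apply/subv_bigcapP=> y _; rewrite -memvE memv_ker lfunE /= Nv.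
case: (simX) => _ /(_ N)[u v /NP Nv||].
- rewrite (dbl_expand u) linear_sum mulmx_suml memv_suml // => p _.
  rewrite linearZ -scalemxAl memvZ //; apply/NP=> y.
  rewrite mulmxA -(mulmxA _ (X _)) dmod_basisM.
  by case: ifP => _; rewrite ?Nv // mulmx0 mul0mx.
- move=> N0; rewrite -cokermx_eq0; apply/eqP/eq_mx_on_columns => c.
  rewrite mul0mx; set d := _ *m c.
  have Ud : U *m d = 0 by rewrite mulmxA mulmx_coker mul0mx.
  suff: C *m d \in N.
    by rewrite N0 memv0 => /eqP Cd; rewrite -[d]mul1mx -PC -mulmxA Cd mulmx0.
  (* For y in the centralizer, invariance of [U] applies; otherwise e_a y e_a = 0, since y moves the
     fiber over a elsewhere. *)
  apply/NP=> y; have [ya|ya] := boolP (y \in 'C[a]%g).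
    have /submxP[D rD] := modU y ya.
    rewrite mulmxA -(mulmxA U) -(mulmxA U) -/(r y) [U *m r y]rD.
    by rewrite -mulmxA Ud mulmx0.
  rewrite -{1}[C]mulmx1 -PC (mulmxA C) CP -!mulmxA (mulmxA (X (eb a y))).
  rewrite dmod_basisM mulg1 ifN ?mul0mx ?mulmx0 //.
  apply: contra ya => /eqP ya; apply/cent1P.
  by rewrite /commute [RHS]conjgC ya.
move=> NT; case/eqP: nzU.
have UP : U *m P = 0.
  apply: eq_mx_on_columns => v; rewrite mul0mx.
  have /NP/(_ 1%g) : v \in N by rewrite NT memvf.
  by rewrite -CP -!mulmxA (mulmxA P C) PC mul1mx.
by rewrite -[U]mulmx1 -PC mulmxA UP mul0mx.
Qed.

Lemma simple_is_bundle (R : {set gT}) X :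
  is_transversal R (classes [set: gT]) [set: gT] -> dsimple X ->
  exists a chi, Gamma R a chi /\ is_bundle a chi X.
Proof.
move=> trR simX.
have [g Xg] : exists g, X (eb g 1%g) != 0.
  apply: contrapT => noX; case: simX => X_gt0 _.
  have : 1%:M = 0 :> 'M[k]_(dim X).
    rewrite -dmod_sum_basis1 big1 // => g _.
    by apply/eqP/negPn/negP => Xg; apply: noX; exists g.
  move=> /matrixP/(_ (Ordinal X_gt0) (Ordinal X_gt0))/eqP.
  by rewrite !mxE eqxx oner_eq0.
have cg : (g ^: [set: gT])%g \in classes [set: gT] by apply: imset_f; rewrite inE.
pose a := transversal_repr g R (g ^: [set: gT])%g.
have aR : a \in R by apply: (repr_mem_transversal trR).
have ag : a \in (g ^: [set: gT])%g by apply: (repr_mem_pblock trR).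
have Xa : X (eb a 1%g) != 0 by rewrite (simple_support simX Xg).
have [chi irrchi chiE] := simple_fiber_irreducible simX Xa.
by exists a, chi; split=> //; split=> //; apply: simple_support.
Qed.

End Semisimplicity.

(** * The regular module and its trace *)

Section Regular.

Set Implicit Arguments.
Unset Strict Implicit.

Variables (k : fieldType) (gT : finGroupType).

Local Notation eb := (dbl_basis k).
Local Notation DG := (Defs.double k gT).

Lemma dbl_mulE (u v : DG) g z :
  (u * v) (g, z) = \sum_(x : gT) u (g, x) * v ((g ^ x)%g, (x^-1 * z)%g).
Proof. by rewrite ffunE. Qed.

Lemma dbl_basis_mulE g x (v : DG) a z :
  (eb g x * v) (a, z) = (a == g)%:R * v ((g ^ x)%g, (x^-1 * z)%g).
Proof.
rewrite dbl_mulE (bigD1 x) //= ffunE xpair_eqE eqxx andbT big1 ?addr0.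
  by case: eqP => [->|]; rewrite ?mul0r.
by move=> y /negPf yx; rewrite ffunE xpair_eqE yx andbF mul0r.
Qed.

Lemma dbl_mul_basisE (u : DG) h y a z :
  (u * eb h y) (a, z) = (a ^ (z * y^-1) == h)%g%:R * u (a, (z * y^-1)%g).
Proof.
rewrite dbl_mulE (bigD1 (z * y^-1)%g) //= ffunE xpair_eqE invMg invgK mulgKV.
rewrite eqxx andbT mulrC big1 ?addr0 // => x xz; rewrite ffunE xpair_eqE.
have [/(canRL (mulKVg x)) zE|] := (x^-1 * z)%g =P y; last by rewrite andbF mulr0.
by rewrite zE mulgK eqxx in xz.
Qed.

(** Left multiplication by [u] has diagonal entry u(g,1) at e_g z, for each of the |G| values of z.
    This trace later shows that the part cut out by [triple_idem] still meets every fiber over K. *)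
Lemma regular_dmod : exists X : dmod k gT, forall u,
  \tr (X u) = #|gT|%:R * \sum_g u (g, 1%g).
Proof.
pose n := #|{: gT * gT}|.
pose b (i : 'I_n) := enum_val i : gT * gT.
pose act (u : DG) : 'M[k]_n := \matrix_(i, j) (u * eb (b j).1 (b j).2) (b i).
have actL : linear act.
  by move=> c u v; apply/matrixP=> i j; rewrite !mxE mulrDl -scalerAl !ffunE.
have actM : monoid_morphism act.
  split=> [|u v]; apply/matrixP=> i j; rewrite !mxE.
    rewrite mul1r ffunE -surjective_pairing (inj_eq enum_val_inj).
    by rewrite -[i == j]/(_ == _).
  rewrite -mulrA [v * _]dbl_expand mulr_sumr sum_ffunE.
  rewrite (reindex_onto b enum_rank) => [|p _]; last exact: enum_rankK.
  rewrite (eq_bigl xpredT) => [|l]; last by rewrite /b enum_valK eqxx.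
  apply: eq_bigr => l _; rewrite !mxE -scalerAr ffunE.
  by rewrite mulrC.
pose actH := GRing.isLinear.Build k DG 'M[k]_n _ act actL.
pose actMH := GRing.isMonoidMorphism.Build DG 'M[k]_n act actM.
pose actLR : {lrmorphism DG -> 'M[k]_n} := HB.pack act actH actMH.
exists (DMod actLR) => u /=; rewrite /mxtrace.
rewrite (eq_bigr (fun i => (u * eb (b i).1 (b i).2) (b i))) => [|i _]; last first.
  by rewrite mxE.
rewrite -(reindex b (P := xpredT) (F := fun p => (u * eb p.1 p.2) p)) /=; last first.
  by exists enum_rank => [i|p] _; [exact: enum_valK | exact: enum_rankK].
rewrite mulr_sumr (eq_bigr (fun p => u (p.1, 1%g))) => [|[g z] _]; last first.
  by rewrite dbl_mul_basisE mulgV conjg1 eqxx mul1r.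
rewrite -(pair_bigA _ (fun g z => u (g, 1%g))) /=; apply: eq_bigr => g _.
by rewrite sumr_const mulr_natl.
Qed.

End Regular.

(** * Fusion subcategories attached to triples *)

Section Isotypic.

Set Implicit Arguments.
Unset Strict Implicit.

Variables (k : fieldType) (gT : finGroupType).
Implicit Types (V W X Y : dmod k gT) (g h x y : gT).

Local Notation eb := (dbl_basis k).
Local Notation dim := dmod_dim.
Local Notation DG := (Defs.double k gT).

(* For a triple (K, H, B), the case h = 1 forces V to be supported on K, since *)
(* B vanishes off K.                                                          *)
Definition isotypic (H : {set gT}) (B : gT -> gT -> k) V : Prop :=
  forall g h, h \in H -> V (eb g h) = B g h *: V (eb g 1%g).

Lemma isotypic_retract H B V W : retract W V -> isotypic H B V -> isotypic H B W.
Proof.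
case=> S [T [hS hT TS]] VP g h hH.
have WE u : W u = T *m V u *m S by rewrite hT -mulmxA TS mulmx1.
by rewrite !WE VP // -scalemxAr -scalemxAl.
Qed.

Lemma isotypic_diso H B V W : diso V W -> isotypic H B V -> isotypic H B W.
Proof. by case=> T [S [hT hS TS ST]]; apply: isotypic_retract; exists S, T. Qed.

Lemma isotypic_dzero H B : isotypic H B (dzero k gT).
Proof. by move=> g h _; apply/matrixP=> -[]. Qed.

Lemma isotypic_dadd H B V W :
  isotypic H B V -> isotypic H B W -> isotypic H B (dadd V W).
Proof.
move=> VP WP g h hH; rewrite -[LHS]/(block_mx _ _ _ _) VP // WP //.
by rewrite [RHS]scale_block_mx !scaler0.
Qed.

Lemma isotypic_bigdadd H B n (F : 'I_n -> dmod k gT) :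
  (forall i, isotypic H B (F i)) ->
  isotypic H B (\big[@dadd k gT/dzero k gT]_(i < n) F i).
Proof.
move=> FP; elim/big_ind: _ => //; first exact: isotypic_dzero.
exact: isotypic_dadd.
Qed.

Hypothesis pchar_k : [pchar k] =i pred0.

Lemma idempotent_trace n (E : 'M[k]_n) : E *m E = E -> \tr E = (\rank E)%:R.
Proof.
move=> /(idempotent_factor E)[r [C [R [RC CR <-]]]].
by rewrite -CR mxtrace_mulC RC mxtrace1.
Qed.

Lemma idempotent_trace_eq0 n (E : 'M[k]_n) : E *m E = E -> (\tr E == 0) = (E == 0).
Proof. by move=> /idempotent_trace->; rewrite (iffLR (pcharf0P _)) // mxrank_eq0. Qed.

Variables (K H : {group gT}) (B : gT -> gT -> k).
Hypothesis triple : centralizing_triple K H B.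

Lemma triple_memJl x y : (y ^ x \in K)%g = (y \in K).
Proof.
case: triple => -[_ /normal_norm/fintype.subsetP nK] _ _ _ _.
by rewrite memJ_norm ?nK ?inE.
Qed.

Lemma triple_memJr x y : (y ^ x \in H)%g = (y \in H).
Proof.
case: triple => _ [_ /normal_norm/fintype.subsetP nH] _ _ _.
by rewrite memJ_norm ?nH ?inE.
Qed.

Lemma triple_conj y h : y \in K -> h \in H -> (y ^ h)%g = y.
Proof.
by case: triple => _ _ cKH _ _ yK hH; rewrite conjgE (cKH y h) // mulKg.
Qed.

Lemma triple_neq0 y h : (B y h != 0) = (y \in K) && (h \in H).
Proof. by case: triple. Qed.

Lemma triple_eq0l y h : y \notin K -> B y h = 0.
Proof. by move=> yK; apply/eqP/negPn; rewrite triple_neq0 (negPf yK). Qed.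

Lemma triple_eq0r y h : h \notin H -> B y h = 0.
Proof. by move=> hH; apply/eqP/negPn; rewrite triple_neq0 (negPf hH) andbF. Qed.

Lemma tripleMl y z h : y \in K -> z \in K -> h \in H ->
  B (y * z)%g h = B y h * B z h.
Proof. by case: triple => _ _ _ _ [BM _ _]; apply: BM. Qed.

Lemma tripleMr y h l : y \in K -> h \in H -> l \in H ->
  B y (h * l)%g = B y h * B y l.
Proof. by case: triple => _ _ _ _ [_ BM _]; apply: BM. Qed.

Lemma triple1l h : h \in H -> B 1%g h = 1.
Proof.
move=> hH; have nz : B 1%g h != 0 by rewrite triple_neq0 group1.
by apply: (mulfI nz); rewrite -tripleMl ?group1 // mulg1 mulr1.
Qed.

Lemma triple1r y : y \in K -> B y 1%g = 1.
Proof.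
move=> yK; have nz : B y 1%g != 0 by rewrite triple_neq0 yK group1.
by apply: (mulfI nz); rewrite -tripleMr ?group1 // mulg1 mulr1.
Qed.

Lemma tripleVl y h : y \in K -> h \in H -> B y^-1%g h = (B y h)^-1.
Proof.
move=> yK hH; apply: (mulrI (x := B y h)); first by rewrite unitfE triple_neq0 yK.
by rewrite -tripleMl ?groupV // mulgV triple1l // mulfV // triple_neq0 yK.
Qed.

Lemma tripleVr y h : y \in K -> h \in H -> B y h^-1%g = (B y h)^-1.
Proof.
move=> yK hH; apply: (mulrI (x := B y h)); first by rewrite unitfE triple_neq0 yK.
by rewrite -tripleMr ?groupV // mulgV triple1r // mulfV // triple_neq0 yK.
Qed.

Lemma tripleJ x y h : B (y ^ x)%g (h ^ x)%g = B y h.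
Proof.
have [yK|yK] := boolP (y \in K); last by rewrite !triple_eq0l ?triple_memJl.
have [hH|hH] := boolP (h \in H); last by rewrite !triple_eq0r ?triple_memJr.
case: triple => _ _ _ _ [_ _ BJ]; rewrite -[RHS](BJ x^-1%g) //.
by rewrite invgK !conjgE !mulgA.
Qed.

Lemma isotypic_eq0 V g : isotypic H B V -> g \notin K -> V (eb g 1%g) = 0.
Proof. by move=> VP gK; rewrite VP // triple_eq0l // scale0r. Qed.

Lemma isotypic_supp V g : isotypic H B V -> V (eb g 1%g) != 0 -> g \in K.
Proof. by move=> VP; apply: contraR => /(isotypic_eq0 VP)/eqP. Qed.

Lemma isotypic_dunit : isotypic H B (dunit k gT).
Proof.
move=> g h hH /=; rewrite /dunit_act !dbl_counitE.
have [->|_] := eqVneq g 1%g; first by rewrite triple1l // scale1r.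
by rewrite raddf0 scaler0.
Qed.

Lemma isotypic_dtens V W :
  isotypic H B V -> isotypic H B W -> isotypic H B (dtens V W).
Proof.
move=> VP WP g h hH; rewrite -[LHS]/(dtens_act V W _) -[_ (eb g 1%g)]/(dtens_act V W _).
rewrite !dtens_actE scaler_sumr; apply: eq_bigr => s _.
have [sK|sK] := boolP (s \in K); last first.
  rewrite (VP s h) // (isotypic_eq0 VP sK) scaler0.
  by apply/matrixP=> i j; rewrite !mxE !mul0r mulr0.
have [tK|tK] := boolP (s^-1 * g \in K)%g; last first.
  rewrite (WP _ h) // (isotypic_eq0 WP tK) scaler0.
  by apply/matrixP=> i j; rewrite !mxE !mulr0.
(* Both s and s^-1 g lie in K here, so multiplicativity in the first argument matches the
   coproduct. *)
have -> : B g h = B s h * B (s^-1 * g)%g h by rewrite -tripleMl // mulKVg.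
rewrite VP // WP //; apply/matrixP=> i j; rewrite !mxE mulrACA //.
Qed.

(** The antipode inverts both arguments, and B(g^-1, h^-1) = B(g, h). *)
Lemma isotypic_ddual V : isotypic H B V -> isotypic H B (ddual V).
Proof.
move=> VP g h hH; rewrite -[LHS]/(_^T) -[_ (eb g 1%g)]/(_^T).
rewrite !dbl_antipodeE -linearZ; congr (_^T).
have [gK|gK] := boolP (g \in K); last first.
  rewrite VP ?groupV // isotypic_eq0 ?triple_memJl ?groupV // invg1.
  by rewrite isotypic_eq0 ?triple_memJl ?groupV // !scaler0.
rewrite !triple_conj ?groupV // VP ?groupV // invg1.
by rewrite tripleVl ?groupV // tripleVr // invrK.
Qed.

Lemma isotypic_fusion : fusion_subcategory (isotypic H B : set (dmod k gT)).
Proof.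
split.
- by move=> V W VW; apply: isotypic_diso VW.
- exact: isotypic_dunit.
- exact: isotypic_dzero.
- exact: isotypic_dadd.
- by move=> V W; apply: isotypic_retract (dadd_retract V W).
- exact: isotypic_dtens.
exact: isotypic_ddual.
Qed.

Lemma bundle_isotypic a chi V : a \in K -> is_bundle a chi V ->
  {in H, forall h, chi h = B a h * chi 1%g} -> isotypic H B V.
Proof.
move=> aK [_ suppV chiV] chiB.
have chiE h : h \in H -> \tr (V (eb a h)) = chi h.
  by move=> hH; apply: chiV; apply/cent1P; rewrite /commute [RHS]conjgC triple_conj.
have nzH : #|H|%:R != 0 :> k by exact: natr_cardG_neq0.
pose p := #|H|%:R^-1 *: \sum_(h in H) (B a h)^-1 *: V (eb a h).
have Vp h : h \in H -> V (eb a h) *m p = B a h *: p.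
  move=> hH; rewrite -scalemxAr [RHS]scalerA [_ * _^-1]mulrC -scalerA; congr (_ *: _).
  rewrite mulmx_sumr scaler_sumr [RHS](reindex_inj (mulgI h)) /=.
  rewrite [RHS](eq_bigl (mem H)) => [|l]; last by rewrite groupMl.
  apply: eq_bigr => l lH; rewrite -scalemxAr scalerA tripleMr //.
  rewrite invfM mulrA mulfV ?mul1r ?triple_neq0 ?aK //.
  by rewrite dmod_basisM triple_conj // eqxx.
have pp : p *m p = p.
  rewrite {1}/p -scalemxAl mulmx_suml (eq_bigr (fun=> p)) => [|h hH].
    by rewrite sumr_const -scaler_nat scalerA mulVf // scale1r.
  by rewrite -scalemxAl Vp // scalerA mulVf ?scale1r // triple_neq0 aK.
have p1 : p *m V (eb a 1%g) = p.
  rewrite -scalemxAl mulmx_suml; congr (_ *: _); apply: eq_bigr => h hH.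
  by rewrite -scalemxAl dmod_basisM triple_conj // eqxx mulg1.
(* e_a - p is an idempotent, and its trace is chi(1) minus an average of |H| terms all equal to
   chi(1). *)
have V1 : V (eb a 1%g) = p.
  apply/eqP; rewrite -subr_eq0 -idempotent_trace_eq0; last first.
    by rewrite mulmxBr !mulmxBl dmod_basis1M p1 Vp // triple1r // scale1r pp subrr subr0.
  rewrite raddfB /= chiE // mxtraceZ raddf_sum /=.
  rewrite (eq_bigr (fun=> chi 1%g)) => [|h hH].
    by rewrite sumr_const -[chi 1%g *+ _]mulr_natl mulKf // subrr.
  by rewrite mxtraceZ chiE // chiB // mulKf // triple_neq0 aK.
have Va h : h \in H -> V (eb a h) = B a h *: V (eb a 1%g).
  by move=> hH; rewrite -{1}dmod_basisM1 triple_conj // V1 Vp.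
move=> g h hH.
(* Off the class of a, e_g acts as 0; on the class, the relation at a is transported by conjugation,
   under which B is invariant. *)
have [/eqP Vg|] := boolP (V (eb g 1%g) == 0).
  by rewrite dmod_basis_eq0 // Vg scaler0.
rewrite suppV => /imsetP[x _ ->].
have [l lH ->] : exists2 l, l \in H & h = (l ^ x)%g.
  by exists (h ^ x^-1)%g; rewrite ?triple_memJr ?conjgKV.
rewrite -[X in _ = _ *: V (eb _ X)](conj1g x) !dmod_basisJ Va // tripleJ conjg1.
by rewrite (triple_conj aK lH) -scalemxAr -scalemxAl.
Qed.

Lemma isotypic_bundle a chi V : isotypic H B V -> is_bundle a chi V ->
  [/\ a \in K, {in H, forall h, chi h = B a h * chi 1%g} & chi 1%g != 0].
Proof.
move=> VP [_ suppV chiV].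
have Va : V (eb a 1%g) != 0 by rewrite suppV class_refl.
have aK := isotypic_supp VP Va.
have chi1 : \tr (V (eb a 1%g)) = chi 1%g by apply: chiV; apply: group1.
split=> // [h hH|]; last by rewrite -chi1 idempotent_trace_eq0 ?dmod_basis1M.
have hC : h \in 'C[a]%g by apply/cent1P; rewrite /commute [RHS]conjgC triple_conj.
by rewrite -(chiV h hC) (VP a h hH) mxtraceZ chi1.
Qed.

Lemma S_of_isotypic (R : {set gT}) :
  is_transversal R (classes [set: gT]) [set: gT] ->
  S_of R K H B = (isotypic H B : set (dmod k gT)).
Proof.
move=> trR; apply/seteqP; split=> V.
  case=> n [F [VF FP]]; apply: isotypic_diso (diso_sym VF) _.
  apply: isotypic_bigdadd => i; have [a [chi [_ aK bF chiB]]] := FP i.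
  exact: bundle_isotypic chiB.
move=> VP; have [n [F [VF FP]]] := semisimple pchar_k V.
exists n, F; split=> // i; have [simF rF] := FP i.
have FiP := isotypic_retract rF VP.
have [a [chi [Gchi bF]]] := simple_is_bundle trR simF.
by have [aK chiB _] := isotypic_bundle FiP bF; exists a, chi.
Qed.

(* Since B vanishes off K x H and 0^-1 = 0, this is supported on K x H.        *)
Definition triple_idem : DG := [ffun p => (B p.1 p.2)^-1 / #|H|%:R].

Lemma triple_idem_eq0 g x : x \notin H -> triple_idem (g, x) = 0.
Proof. by move=> xH; rewrite ffunE /= triple_eq0r // invr0 mul0r. Qed.

(** Moving e_g x across conjugates the coordinates by x, which leaves B unchanged, while conjugation
    by H fixes K pointwise. *)
Lemma triple_idem_comm u : triple_idem * u = u * triple_idem.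
Proof.
rewrite (dbl_expand u) mulr_sumr mulr_suml; apply: eq_bigr => -[g x] _ /=.
rewrite -scalerAr -scalerAl; congr (_ *: _); apply/ffunP=> -[a z].
rewrite dbl_basis_mulE dbl_mul_basisE.
have -> : triple_idem ((g ^ x)%g, (x^-1 * z)%g) = triple_idem (g, (z * x^-1)%g).
  by rewrite !ffunE /= -(tripleJ x g) [((_ * _) ^ x)%g]conjgE mulgKV.
have [zH|zH] := boolP (z * x^-1 \in H)%g; last by rewrite !triple_idem_eq0 ?mulr0.
have [aK|aK] := boolP (a \in K).
  by rewrite triple_conj //; case: eqP => [->|]; rewrite ?mul0r.
rewrite {1}ffunE /= triple_eq0l // invr0 mul0r mulr0.
case: eqP => [ag|]; last by rewrite mul0r.
by rewrite -ag ffunE /= triple_eq0l // invr0 mul0r mulr0.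
Qed.

Lemma basis_triple_idem g h : h \in H ->
  eb g h * triple_idem = B g h *: (eb g 1%g * triple_idem).
Proof.
move=> hH; apply/ffunP=> -[a z]; rewrite [RHS]ffunE !dbl_basis_mulE.
rewrite conjg1 invg1 mul1g [RHS]mulrCA; congr (_ * _).
have [gK|gK] := boolP (g \in K); last first.
  by rewrite !ffunE /= !triple_eq0l ?triple_memJl // invr0 !mul0r.
rewrite triple_conj // !ffunE /=.
have [zH|zH] := boolP (z \in H); last first.
  have hzH : (h^-1 * z)%g \notin H by rewrite groupMl ?groupV.
  by rewrite (triple_eq0r g zH) (triple_eq0r g hzH) invr0 mul0r mulr0.
by rewrite tripleMr ?groupV // tripleVr // invfM invrK mulrA.
Qed.

Lemma triple_idemM : triple_idem * triple_idem = triple_idem.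
Proof.
have nzH : #|H|%:R != 0 :> k by exact: natr_cardG_neq0.
rewrite {1}(dbl_expand triple_idem) mulr_suml.
pose F g h : DG := triple_idem (g, h) *: (eb g h * triple_idem).
rewrite (eq_bigr (fun p => F p.1 p.2)) => [|[g h] _]; last by rewrite -scalerAl.
rewrite -(pair_bigA _ F) /F /=.
rewrite -[RHS]mul1r dbl_oneE mulr_suml; apply: eq_bigr => g _.
have [gK|gK] := boolP (g \in K); last first.
  rewrite [RHS]basis_triple_idem // triple_eq0l // scale0r big1 // => h _.
  by rewrite ffunE /= triple_eq0l // invr0 mul0r !scale0r.
rewrite (bigID (mem H)) /= [X in _ + X]big1 ?addr0 => [|h hH]; last first.
  by rewrite triple_idem_eq0 // scale0r.
rewrite (eq_bigr (fun=> #|H|%:R^-1 *: (eb g 1%g * triple_idem))) => [|h hH].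
  by rewrite sumr_const -scaler_nat scalerA mulfV // scale1r.
rewrite basis_triple_idem // scalerA ffunE /= mulrAC mulVf ?mul1r //.
by rewrite triple_neq0 gK.
Qed.

(** [W] is the regular module cut by [triple_idem], so the trace of e_g x on it is |G| times the
    coordinate of [triple_idem] at (g^x, x^-1). This is nonzero for x = 1 and g in K, and zero for x
    outside H; the two facts separate K and H respectively. *)
Lemma isotypic_generator : exists W, [/\ isotypic H B W,
  forall g, g \in K -> \tr (W (eb g 1%g)) != 0 &
  forall h, h \notin H -> \tr (W (eb 1%g h)) = 0].
Proof.
have [X trX] := regular_dmod k gT; pose E := X triple_idem.
have hE : dhom (V := X) (W := X) E.
  by move=> u; rewrite -[LHS]rmorphM triple_idem_comm rmorphM.
have EE : E *m E = E by rewrite -[LHS]rmorphM triple_idemM.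
have [W [C [P [hC hP PC CP dW]]]] := split_idempotent hE EE.
have WE u : W u = P *m X (u * triple_idem) *m C.
  rewrite rmorphM -[X u * _]/(X u *m E) -CP.
  by rewrite !mulmxA hP -!mulmxA PC mulmx1 PC mulmx1.
have trW u : \tr (W u) = #|gT|%:R * \sum_g (u * triple_idem) (g, 1%g).
  rewrite WE -mulmxA mxtrace_mulC -mulmxA CP -[_ *m E]rmorphM -mulrA.
  by rewrite triple_idemM trX.
have sumE g x : \sum_a (eb g x * triple_idem) (a, 1%g) =
    triple_idem ((g ^ x)%g, (x^-1)%g).
  rewrite (bigD1 g) //= big1 ?addr0 => [|a /negPf ag]; rewrite dbl_basis_mulE.
    by rewrite eqxx mul1r mulg1.
  by rewrite ag mul0r.
exists W; split=> [g h hH|g gK|h hH].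
- by rewrite !WE basis_triple_idem // linearZ -scalemxAr -scalemxAl.
- rewrite trW sumE invg1 conjg1 ffunE /= triple1r // invr1 mul1r.
  by rewrite mulf_neq0 ?natr_card_neq0 // invr_eq0 natr_cardG_neq0.
by rewrite trW sumE triple_idem_eq0 ?mulr0 // groupV.
Qed.

End Isotypic.

(** * Coefficients of a fusion subcategory *)

Section Coefficients.

Set Implicit Arguments.
Unset Strict Implicit.

Variables (k : fieldType) (gT : finGroupType).
Implicit Types (V W X Y : dmod k gT) (g h x y : gT).

Local Notation eb := (dbl_basis k).
Local Notation dim := dmod_dim.

Variable D : set (dmod k gT).
Hypothesis fusD : fusion_subcategory D.

(* Coefficients x |-> l (e_h x) c, normalized so that the other e_g contribute *)
(* 0: without this, tensor products would only give convolutions over g.      *)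
Definition fusion_coef h (f : gT -> k) : Prop :=
  exists V (l : 'rV_(dim V)) (c : 'cV_(dim V)), D V /\
    forall g x, (l *m V (eb g x) *m c) 0 0 = (g == h)%:R * f x.

Lemma coefI V (l : 'rV_(dim V)) (c : 'cV_(dim V)) h :
  D V -> fusion_coef h (fun x => (l *m V (eb h x) *m c) 0 0).
Proof.
move=> DV; exists V, (l *m V (eb h 1%g)), c; split=> // g x.
rewrite -(mulmxA l) dmod_basisM conjg1 mul1g eq_sym.
by case: eqP => _; rewrite ?mul1r // mulmx0 !mul0mx mxE mul0r.
Qed.

Lemma coefE V i j h : D V -> fusion_coef h (fun x => V (eb h x) i j).
Proof.
move=> DV; have := coefI (delta_mx 0 i) (delta_mx j 0) h DV.
by congr fusion_coef; apply/funext=> x; rewrite -rowE -colE !mxE.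
Qed.

Lemma eq_coef h f f' : f =1 f' -> fusion_coef h f -> fusion_coef h f'.
Proof. by move=> /funext->. Qed.

Lemma coef_scale h a f : fusion_coef h f -> fusion_coef h (fun x => a * f x).
Proof.
case=> V [l [c [DV lc]]]; exists V, (a *: l), c; split=> // g x.
by rewrite -!scalemxAl mxE lc mulrCA.
Qed.

Lemma coef_add h f f' : fusion_coef h f -> fusion_coef h f' ->
  fusion_coef h (fun x => f x + f' x).
Proof.
case=> V [l [c [DV lc]]] [V' [l' [c' [DV' lc']]]].
exists (dadd V V'), (row_mx l l'), (col_mx c c'); split; first exact: fusion_add.
move=> g x; rewrite -[dadd V V' _]/(block_mx _ _ _ _) mul_row_block.
by rewrite !mulmx0 addr0 add0r mul_row_col mxE lc lc' mulrDr.
Qed.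

(** By the normalization of coefficients, only s = g survives in the sum over the coproduct, so the
    product is pointwise and degrees multiply. *)
Lemma coef_mul g h f f' : fusion_coef g f -> fusion_coef h f' ->
  fusion_coef (g * h)%g (fun x => f x * f' x).
Proof.
case=> V [l [c [DV lc]]] [V' [l' [c' [DV' lc']]]].
exists (dtens V V'), (l *t l'), (c *t c'); split; first exact: fusion_tens.
move=> t x; rewrite -[dtens V V' _]/(dtens_act _ _ _) dtens_actE.
rewrite mulmx_sumr mulmx_suml summxE.
have tensE s : (l *t l' *m (V (eb s x) *t V' (eb (s^-1 * t)%g x)) *m (c *t c')) 0 0 =
    ((s == g)%:R * f x) * ((s^-1 * t == h)%g%:R * f' x).
  by rewrite !tensmx_mul mxE !ord1 lc lc'.
rewrite (eq_bigr _ (fun s _ => tensE s)) (bigD1 g) //= big1 ?addr0; last first.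
  by move=> s /negPf->; rewrite !mul0r.
rewrite eqxx mul1r mulrCA; congr (_%:R * _).
by rewrite -(inj_eq (mulgI g)) mulKVg.
Qed.

Lemma coef_cst a : fusion_coef 1%g (fun=> a).
Proof.
exists (dunit k gT), a%:M, 1%:M; split; first exact: fusion_unit.
move=> g x; rewrite mulmx1 -[dunit k gT _]/(_%:M) -scalar_mxM dbl_counitE mxE eqxx.
by rewrite mulr1n mulrC.
Qed.

Lemma coef_rtrans h f y : fusion_coef h f -> fusion_coef h (fun x => f (x * y)%g).
Proof.
(* The sum of the e_t y over all t is the group element y of D(G). *)
case=> V [l [c [DV lc]]]; exists V, l, ((\sum_t V (eb t y)) *m c); split=> // g x.
rewrite mulmxA -(mulmxA l) mulmx_sumr (bigD1 (g ^ x)%g) //= big1 => [|t tg].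
  by rewrite addr0 dmod_basisMJ lc.
by rewrite dmod_basisM eq_sym (negPf tg).
Qed.

Lemma coef_sum I (r : seq I) h (F : I -> gT -> k) :
  (forall i, fusion_coef h (F i)) -> fusion_coef h (fun x => \sum_(i <- r) F i x).
Proof.
move=> FP; elim: r => [|i r IHr].
  have := coefI (V := dunit k gT) 0 0 h (fusion_unit fusD).
  by apply: eq_coef => x; rewrite big_nil mulmx0 mxE.
by apply: eq_coef (coef_add (FP i) IHr) => x; rewrite big_cons.
Qed.

(** Defined, like [fusion_supp], from the action on all objects rather than from characters of
    simple ones; the agreement with [ker_of] and [supp_of] comes out only after D is known to be
    isotypic. *)
Definition fusion_ker : {set gT} :=
  [set n | `[< forall V, D V -> V (eb 1%g n) = V (eb 1%g 1%g) >]]%SET.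

Definition fusion_supp : {set gT} :=
  [set h | `[< exists2 V, D V & V (eb h 1%g) != 0 >]]%SET.

Lemma fusion_kerP n :
  reflect (forall V, D V -> V (eb 1%g n) = V (eb 1%g 1%g)) (n \in fusion_ker).
Proof. by rewrite inE; apply: asboolP. Qed.

Lemma fusion_suppP h :
  reflect (exists2 V, D V & V (eb h 1%g) != 0) (h \in fusion_supp).
Proof. by rewrite inE; apply: asboolP. Qed.

Lemma fusion_ker_coef n f : n \in fusion_ker -> fusion_coef 1%g f -> f n = f 1%g.
Proof.
move=> /fusion_kerP nN [V [l [c [DV lc]]]].
by have := lc 1%g n; rewrite nN // lc eqxx !mul1r.
Qed.

Lemma neq_mx_entry m n (A B : 'M[k]_(m, n)) : A <> B -> exists i j, A i j <> B i j.
Proof.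
move=> AB; apply: contrapT => noij; apply: AB; apply/matrixP=> i j.
by apply: contrapT => Aij; apply: noij; exists i, j.
Qed.

Lemma fusion_supp_coef h : h \in fusion_supp -> exists2 f, fusion_coef h f & f 1%g = 1.
Proof.
case/fusion_suppP=> V DV /eqP/neq_mx_entry[i [j]]; rewrite mxE => /eqP nz.
exists (fun x => (V (eb h 1%g) i j)^-1 * V (eb h x) i j); last by rewrite mulVf.
exact/coef_scale/coefE.
Qed.

(** Lagrange interpolation in degree 1: each y outside the kernel has a coefficient F with F(y)
    different from F(1), and contributes the factor (F - F(y)) / (F(1) - F(y)), which is 1 on the
    kernel. *)
Lemma fusion_ker_separate (s : seq gT) : exists f, [/\ fusion_coef 1%g f,
  forall n, n \in fusion_ker -> f n = 1 &
  forall y, y \in s -> y \notin fusion_ker -> f y = 0].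
Proof.
elim: s => [|y s [f [fA f1 f0]]]; first by exists (fun=> 1); split=> //; apply: coef_cst.
have [yN|yN] := boolP (y \in fusion_ker).
  by exists f; split=> // z; rewrite inE => /orP[/eqP->|/f0//]; rewrite yN.
have [V [DV /neq_mx_entry[i [j]]]] : exists V, D V /\ V (eb 1%g y) <> V (eb 1%g 1%g).
  apply: contrapT => noV; case/fusion_kerP: yN => V DV.
  by apply: contrapT => Vy; apply: noV; exists V.
pose F x := V (eb 1%g x) i j; rewrite -/(F y) -/(F 1%g) => /eqP Fy.
have FA : fusion_coef 1%g F by apply: coefE.
pose F' x := (F 1%g - F y)^-1 * (F x + - F y).
have F'A : fusion_coef 1%g F' by apply/coef_scale/coef_add/coef_cst.
exists (fun x => f x * F' x); split=> [|n nN|z].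
- by have := coef_mul fA F'A; rewrite mulg1.
- by rewrite f1 // /F' (fusion_ker_coef nN FA) mulVf ?mulr1 // subr_eq0 eq_sym.
rewrite inE => /orP[/eqP-> _|/f0/[apply]->]; last by rewrite mul0r.
by rewrite /F' subrr !mulr0.
Qed.

Lemma coef_indicator : fusion_coef 1%g (fun x => (x \in fusion_ker)%:R).
Proof.
have [f [fA f1 f0]] := fusion_ker_separate (enum gT).
apply: eq_coef fA => x; have [/f1//|xN] := boolP (x \in fusion_ker).
by rewrite f0 // mem_enum.
Qed.

Lemma fusion_suppV h : h \in fusion_supp -> (h^-1)%g \in fusion_supp.
Proof.
case/fusion_suppP=> V DV nz; apply/fusion_suppP; exists (ddual V); first exact: fusion_dual.
rewrite -[ddual V _]/(_^T) dbl_antipodeE invgK conjg1 invg1.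
by apply: contra_neq nz => Vh; rewrite -[LHS]trmxK Vh trmx0.
Qed.

Lemma coef_supp h f : fusion_coef h f -> f 1%g != 0 -> h \in fusion_supp.
Proof.
case=> V [l [c [DV lc]]] nz; apply/fusion_suppP; exists V => //.
apply: contra_neq nz => Vh; have := lc h 1%g.
by rewrite Vh mulmx0 mul0mx mxE eqxx mul1r.
Qed.

(* If [f'] lies in degree h^-1 then [F f'] lies in degree 1, hence is constant *)
(* on the kernel.                                                              *)
Lemma fusion_scalar h n : h \in fusion_supp -> n \in fusion_ker ->
  exists2 b, b != 0 & forall V, D V -> V (eb h n) = b *: V (eb h 1%g).
Proof.
move=> hK nN; have [f fA f1] := fusion_supp_coef hK.
have [f' f'A f'1] := fusion_supp_coef (fusion_suppV hK).
have Ff' F : fusion_coef h F -> F n * f' n = F 1%g.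
  move=> FA; have := coef_mul FA f'A; rewrite mulgV.
  by move=> /(fusion_ker_coef nN)->; rewrite f'1 mulr1.
have nz : f' n != 0.
  by apply/eqP=> f'n; have := Ff' f fA; rewrite f'n mulr0 f1 => /esym/eqP; rewrite oner_eq0.
exists (f' n)^-1; first by rewrite invr_eq0.
move=> V DV; apply/matrixP=> i j; rewrite mxE.
by rewrite -(Ff' _ (coefE i j h DV)) mulrC mulfK.
Qed.

Lemma scalemx_injl m n (A : 'M[k]_(m, n)) : A != 0 -> injective (fun a => a *: A).
Proof.
move=> nz a b /eqP; rewrite -subr_eq0 -scalerBl scaler_eq0 (negPf nz) orbF.
by rewrite subr_eq0 => /eqP.
Qed.

Lemma normal_setT (A : {group gT}) :
  (forall g x, g \in A -> (g ^ x)%g \in A) -> (A <| [set: gT])%g.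
Proof.
move=> AJ; apply/normalP; split=> [|x _]; first exact: finset.subsetT.
by apply/setP=> y; rewrite mem_conjg; apply/idP/idP => /AJ;
  [move/(_ x); rewrite conjgKV | apply].
Qed.

Lemma fusion_isotypic : exists (K H : {group gT}) (B : gT -> gT -> k),
  [/\ centralizing_triple K H B, K = fusion_supp :> {set gT},
      H = fusion_ker :> {set gT} & forall V, D V -> isotypic H B V].
Proof.
have gK : group_set fusion_supp.
  apply/group_setP; split.
    by apply/(coef_supp (coef_cst 1)); rewrite oner_eq0.
  move=> g h /fusion_supp_coef[f fA f1] /fusion_supp_coef[f' f'A f'1].
  by apply: (coef_supp (coef_mul fA f'A)); rewrite f1 f'1 mulr1 oner_eq0.
have gH : group_set fusion_ker.
  apply/group_setP; split; first by apply/fusion_kerP.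
  move=> n m /fusion_kerP nN /fusion_kerP mN; apply/fusion_kerP=> V DV.
  by rewrite -dmod_basisMJ conj1g nN // mN // dmod_basis1M.
pose K := Group gK; pose H := Group gH.
have [B BP] : exists B : gT -> gT -> k, forall g h,
    (B g h != 0) = (g \in K) && (h \in H) /\
    (g \in K -> h \in H -> forall V, D V -> V (eb g h) = B g h *: V (eb g 1%g)).
  have /choice[B BP] : forall p : gT * gT, exists b : k,
      (b != 0) = (p.1 \in K) && (p.2 \in H) /\
    (p.1 \in K -> p.2 \in H -> forall V, D V -> V (eb p.1 p.2) = b *: V (eb p.1 1%g)).
    move=> [g h] /=; have [gK'|gK'] := boolP (g \in K); last by exists 0; rewrite eqxx.
    have [hH|hH] := boolP (h \in H); last by exists 0; rewrite eqxx.
    by have [b nz bP] := fusion_scalar gK' hH; exists b; rewrite nz.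
  by exists (fun g h => B (g, h)) => g h; apply: (BP (g, h)).
have Bnz g h : (B g h != 0) = (g \in K) && (h \in H) by have [] := BP g h.
have BE g h V : g \in K -> h \in H -> D V -> V (eb g h) = B g h *: V (eb g 1%g).
  by move=> gK' hH DV; have [_ ->] := BP g h.
have conjK g x : g \in K -> (g ^ x)%g \in K.
  case/fusion_suppP=> V DV nz; apply/fusion_suppP; exists V => //.
  by apply: contra_neq nz; apply: (iffLR (dmod_basisJ_eq0 _ _ _)).
have conjH n x : n \in H -> (n ^ x)%g \in H.
  move/fusion_kerP=> nN; apply/fusion_kerP=> V DV.
  rewrite -[in LHS](conj1g x) dmod_basisJ nN // dmod_basisM !conj1g eqxx mulg1.
  by rewrite dmod_basisM conj1g eqxx mulVg.
have nzK g : g \in K -> exists2 V, D V & V (eb g 1%g) != 0 by move/fusion_suppP.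
have cent g h : g \in K -> h \in H -> (g ^ h)%g = g.
  move=> gK' hH; have [V DV nz] := nzK g gK'; apply/eqP.
  (* If h moved g, then e_g h e_g would vanish, but it is B(g,h) e_g, which is nonzero on V. *)
  have := dmod_basisM V g h g 1%g; case: eqP => // _ /eqP.
  rewrite BE // -scalemxAl dmod_basis1M scaler_eq0 (negPf nz) orbF.
  by rewrite -[_ == 0]negbK Bnz gK' hH.
exists K, H, B; split=> //; last first.
  move=> V DV g h hH; have [gK'|gK'] := boolP (g \in K); first exact: BE.
  have [/eqP Vg|Vg] := boolP (V (eb g 1%g) == 0).
    by rewrite dmod_basis_eq0 // Vg scaler0.
  by case/fusion_suppP: gK'; exists V.
split=> //.
- by split=> //; apply: (normal_setT (A := K)).
- by split=> //; apply: (normal_setT (A := H)).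
- by move=> g h gK' hH; rewrite /commute conjgC cent.
split.
- move=> g h n gK' hK nH.
  (* Along the kernel, a coefficient of degree t varies by B(t, n); comparing a product of
     coefficients with its factors gives multiplicativity in the first argument. *)
  have BF t F : t \in K -> fusion_coef t F -> F n = B t n * F 1%g.
    move=> tK [V [l [c [DV lc]]]]; have := lc t n.
    rewrite BE // -scalemxAr -scalemxAl mxE lc eqxx !mul1r //.
  have [f fA f1] := fusion_supp_coef gK'; have [f' f'A f'1] := fusion_supp_coef hK.
  have := BF _ _ (groupM gK' hK) (coef_mul fA f'A).
  by rewrite (BF g f) // (BF h f') // f1 f'1 !mulr1.
- move=> g h l gK' hH lH; have [V DV nz] := nzK g gK'.
  apply: (scalemx_injl nz); rewrite /= -BE ?groupM //.
  rewrite -dmod_basisMJ cent // BE // (BE g l) // -scalemxAr -scalemxAl.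
  by rewrite dmod_basis1M scalerA mulrC.
move=> x g h gK' hH.
have [V DV nz] := nzK (g ^ x^-1)%g (conjK _ _ gK').
apply: (scalemx_injl nz).
have JE t : (x * t * x^-1 = t ^ x^-1)%g by rewrite conjgE invgK mulgA.
rewrite /= !JE -BE ?conjK ?conjH //.
rewrite dmod_basisJ (BE g h) // (cent g h) // -scalemxAr -scalemxAl; congr (_ *: _).
by rewrite -[X in _ = V (eb _ X)](conj1g x^-1%g) dmod_basisJ conjg1.
Qed.

(** Only [S] is a module map. This makes the condition stable under sums, and when [M] is the
    identity, averaging turns [T] into a module map ([factors1]). *)
Definition factors_through W (M : 'M_(dim W)) : Prop :=
  exists X (S : 'M_(dim X, dim W)) (T : 'M_(dim W, dim X)),
    [/\ D X, dhom S & M = T *m S].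

Lemma factors_add W (M N : 'M_(dim W)) :
  factors_through M -> factors_through N -> factors_through (W := W) (M + N).
Proof.
case=> X [S [T [DX hS ->]]] [X' [S' [T' [DX' hS' ->]]]].
exists (dadd X X'), (col_mx S S'), (row_mx T T'); split.
- exact: fusion_add.
- by move=> u; rewrite mul_col_mx [RHS]mul_block_col !mul0mx addr0 add0r hS hS'.
by rewrite mul_row_col.
Qed.

Lemma factors_sum W I (r : seq I) (M : I -> 'M_(dim W)) :
  (forall i, factors_through (M i)) -> factors_through (W := W) (\sum_(i <- r) M i).
Proof.
move=> MP; elim: r => [|i r IHr]; last by rewrite big_cons; apply: factors_add.
rewrite big_nil; exists (dunit k gT), 0, 0; split; first exact: fusion_unit.
  by move=> u; rewrite mul0mx mulmx0.
by rewrite mul0mx.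
Qed.

Hypothesis pchar_k : [pchar k] =i pred0.

Lemma factors1 W : factors_through (W := W) 1%:M -> D W.
Proof.
case=> X [S [T [DX hS TS]]].
have rWX : retract W X.
  by exists S, (avg T); split=> //; [apply: avg_hom | apply: split_mono].
have [W' XW _] := retract_summand rWX.
exact: (fusion_summand fusD (fusion_iso fusD XW DX)).
Qed.

(** The identity is [avg 1%:M]; inserting matrix units on both sides breaks it into pieces, each
    depending on W(e_h x) only through its (i,j) entry. That entry equals l e_h x c in an object of
    D, so the piece factors through that object. *)
Lemma coef_mem W :
  (forall h i j, fusion_coef h (fun x => W (eb h x) i j)) -> D W.
Proof.
move=> WA; apply: factors1.
have deltaE : \sum_j delta_mx j j = 1%:M :> 'M[k]_(dim W).
  apply/matrixP=> i j; rewrite summxE !mxE (bigD1 i) //= !mxE eqxx /= eq_sym.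
  rewrite big1 ?addr0 // => l /negPf li; rewrite !mxE eq_sym li //.
rewrite -(avg1 pchar_k W) -deltaE avg_sum; apply: factors_sum => j.
rewrite -[avg _]mul1mx -deltaE mulmx_suml; apply: factors_sum => i.
rewrite -scalemxAr mulmx_sumr scaler_sumr; apply: factors_sum => h.
have [V [l [c [DV lc]]]] := WA h i j.
have lVc g x : l *m V (eb g x) *m c = ((g == h)%:R * W (eb h x) i j)%:M.
  by rewrite [LHS]mx11_scalar lc.
exists V, (avg (c *m delta_mx 0 j : 'M_(dim V, dim W))), (delta_mx i 0 *m l).
split=> //; first exact: avg_hom.
rewrite -[RHS]scalemxAr; congr (_ *: _); rewrite [RHS]mulmx_sumr.
rewrite [RHS](bigD1 h) //= [X in _ + X]big1 ?addr0 => [|g /negPf gh].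
  rewrite !mulmx_sumr; apply: eq_bigr => x _.
  rewrite !mulmxA -(mulmxA _ l) -(mulmxA _ (l *m _)) lVc eqxx mul1r.
  rewrite mul_mx_scalar -scalemxAl mul_delta_mx; congr (_ *m _).
  rewrite -(mul_delta_mx (0 : 'I_1) i i) -(mul_delta_mx (0 : 'I_1) j j) !mulmxA.
  rewrite -!(mulmxA (delta_mx i 0)) [X in _ *m (X *m _)]mx11_scalar.
  by rewrite -rowE -colE !mxE mul_scalar_mx -scalemxAr mul_delta_mx.
rewrite mulmx_sumr big1 // => x _.
rewrite !mulmxA -(mulmxA _ l) -(mulmxA _ (l *m _)) lVc gh mul0r.
by rewrite mul_mx_scalar scale0r !mul0mx.
Qed.

Lemma isotypic_mem (K H : {group gT}) B W : centralizing_triple K H B ->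
  K = fusion_supp :> {set gT} -> H = fusion_ker :> {set gT} ->
  (forall V, D V -> isotypic H B V) -> isotypic H B W -> D W.
Proof.
move=> tr KE HE DP WP; apply: coef_mem => h i j.
have nzH : #|H|%:R != 0 :> k by exact: natr_cardG_neq0.
pose F x := W (eb h x) i j; rewrite -/F.
(* Outside K the function is 0, which is a coefficient of every degree. *)
have [hK|hK] := boolP (h \in K); last first.
  have := coef_scale 0 (coefI (V := dunit k gT) 0 0 h (fusion_unit fusD)).
  apply: eq_coef => x; rewrite mul0r /F dmod_basis_eq0 ?mxE //.
  exact: (isotypic_eq0 tr WP).
have FB n x : n \in H -> F (n * x)%g = B h n * F x.
  move=> nH; rewrite /F -dmod_basisMJ (triple_conj tr) // WP //.
  by rewrite -scalemxAl dmod_basis1M mxE.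
have [f fA f1] : exists2 f, fusion_coef h f & f 1%g = 1.
  by apply: fusion_supp_coef; rewrite -KE.
have fB n : n \in H -> f n = B h n.
  case: fA => V [l [c [DV lc]]] nH; have := lc h n.
  by rewrite (DP V DV h n nH) -scalemxAr -scalemxAl mxE lc eqxx !mul1r f1 mulr1.
pose phi x := f x * (x \in fusion_ker)%:R.
have phiA : fusion_coef h phi by have := coef_mul fA coef_indicator; rewrite mulg1.
(* Substituting y = n^-1 x, each n in H contributes B(h,n)^-1 F(x) B(h,n) = F(x) and the other n
   contribute 0, so this average is [F]. *)
have : fusion_coef h (fun x => #|H|%:R^-1 * \sum_y F y * phi (x * y^-1)%g).
  apply/coef_scale/coef_sum => y; apply: coef_scale.
  exact: (coef_rtrans y^-1%g phiA).
apply: eq_coef => x; rewrite (reindex_inj invg_inj) /=.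
rewrite (reindex_inj (mulgI x^-1%g)) /=.
rewrite (eq_bigr (fun n => (n \in H)%:R * F x)) => [|n _].
  rewrite -mulr_suml -natr_sum -(big_mkcond (mem H)) sum1_card.
  by rewrite mulKf.
rewrite invgK invMg invgK mulKVg /phi -HE.
have [nH|nH] := boolP (n \in H); last by rewrite !mulr0 mul0r.
rewrite mulr1 mul1r fB // FB ?groupV // (tripleVr tr) // mulrAC mulVf ?mul1r //.
by rewrite (triple_neq0 tr) hK.
Qed.

End Coefficients.

(** * Recovering the triple and the bijection *)

Section Triples.

Set Implicit Arguments.
Unset Strict Implicit.

Variables (k : fieldType) (gT : finGroupType) (R : {set gT}).
Hypothesis pchar_k : [pchar k] =i pred0.
Hypothesis trR : is_transversal R (classes [set: gT]) [set: gT].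

Local Notation eb := (dbl_basis k).

Section Recover.

Variables (K H : {group gT}) (B : gT -> gT -> k).
Hypothesis triple : centralizing_triple K H B.

Local Notation D := (isotypic H B : set (dmod k gT)).

Lemma in_Gamma_isotypic a chi : in_Gamma R D a chi ->
  [/\ a \in K, {in H, forall h, chi h = B a h * chi 1%g} & chi 1%g != 0].
Proof. by case=> _ [V VP bV]; apply: isotypic_bundle bV. Qed.

(** Traces add over a decomposition into simple modules, so a nonzero trace is seen by some simple
    summand. *)
Lemma isotypic_simple V u : isotypic H B V -> \tr (V u) != 0 ->
  exists F a chi, [/\ isotypic H B F, \tr (F u) != 0, Gamma R a chi & is_bundle a chi F].
Proof.
move=> VP nz; have [n [F [VF FP]]] := semisimple pchar_k V.
have [i Fi] : exists i, \tr (F i u) != 0.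
  apply: contrapT => noF; move: nz; rewrite (diso_trace u VF) bigdadd_trace big1 ?eqxx //.
  by move=> i _; apply/eqP/negPn/negP => Fi; apply: noF; exists i.
have [simF rF] := FP i; have [a [chi [Ga bF]]] := simple_is_bundle trR simF.
by exists (F i), a, chi; split=> //; apply: isotypic_retract rF VP.
Qed.

Lemma supp_of_isotypic : supp_of R D = K.
Proof.
apply/setP=> y; rewrite inE; apply/asboolP/idP => [[a [chi [g [GD ->]]]]|yK].
  have [aK _ _] := in_Gamma_isotypic GD.
  have := triple_memJl triple g^-1%g a.
  by rewrite conjgE invgK mulgA aK.
have [W [WP nzW _]] := isotypic_generator pchar_k triple.
have [F [a [chi [FP nzF Ga bF]]]] := isotypic_simple WP (nzW y yK).
have Fy : F (eb y 1%g) != 0 by apply: contra_neq nzF => ->; rewrite mxtrace0.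
have [_ suppF _] := bF; rewrite suppF in Fy; case/imsetP: Fy => x _ yE.
exists a, chi, x^-1%g; split; last by rewrite yE conjgE invgK mulgA.
by split=> //; exists F.
Qed.

Lemma ker_of_isotypic : ker_of R D = H.
Proof.
apply/setP=> h; rewrite inE; apply/asboolP/idP => [hker|hH chi GD]; last first.
  have [_ chiB _] := in_Gamma_isotypic GD.
  by rewrite chiB // (triple1l triple) // mul1r.
apply: contraT => hH.
have [W [WP nzW W0]] := isotypic_generator pchar_k triple.
(* The trace of e_1 - e_1 h on a simple bundle over 1 is chi(1) - chi(h), so a summand with nonzero
   trace gives a character whose kernel misses h. *)
have : \tr (W (eb 1%g 1%g - eb 1%g h)) != 0.
  by rewrite (raddfB (dmod_act W)) raddfB /= (W0 h) // subr0 nzW.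
case/(isotypic_simple WP) => F [a [chi [FP]]].
rewrite (raddfB (dmod_act F)) raddfB /= => nzF Ga bF.
have [_ suppF chiF] := bF.
have F1 : F (eb 1%g 1%g) != 0.
  by apply: contra_neq nzF => F1; rewrite (dmod_basis_eq0 h F1) F1 subrr.
have a1 : a = 1%g.
  move: F1; rewrite suppF => /imsetP[x _ /esym/eqP].
  by rewrite conjg_eq1 => /eqP.
case/eqP: nzF; rewrite -a1 !chiF ?a1 ?cent11T ?inE //.
have /hker-> : in_Gamma R D 1%g chi by rewrite -a1; split=> //; exists F.
by rewrite subrr.
Qed.

Lemma isotypic_quotient a chi g h : in_Gamma R D a chi -> h \in H ->
  chi (g * h * g^-1)%g / chi 1%g = B (g^-1 * a * g)%g h.
Proof.
move=> GD hH; have [aK chiB nz] := in_Gamma_isotypic GD.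
have gh : (g * h * g^-1 = h ^ g^-1)%g by rewrite conjgE invgK mulgA.
have ag : (g^-1 * a * g = a ^ g)%g by rewrite conjgE mulgA.
rewrite gh ag chiB ?(triple_memJr triple) // mulfK //.
by rewrite -[RHS](tripleJ triple g^-1%g) conjgK.
Qed.

Lemma bichar_of_isotypic : bichar_of R D = B.
Proof.
apply/funext=> y; apply/funext=> h; rewrite /bichar_of supp_of_isotypic ker_of_isotypic.
case: ifPn => [/andP[yK hH]|]; last by rewrite -(triple_neq0 triple) negbK => /eqP->.
have : y \in supp_of R D by rewrite supp_of_isotypic.
rewrite inE => /asboolP[a [chi [g [GD yE]]]].
(* Every witness of the quotient has the value B(y,h); the default 0 is excluded by the witness that
   y in the support provides. *)
case: xgetP => [v _ [b [psi [x [GD' -> ->]]]]|noQ]; first exact: isotypic_quotient.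
case: (noQ (chi (g^-1 * h * g^-1^-1)%g / chi 1%g)).
by exists a, chi, g^-1%g; split; rewrite ?invgK.
Qed.

End Recover.

Lemma fusion_triple (D : set (dmod k gT)) : fusion_subcategory D ->
  exists (K H : {group gT}) (B : gT -> gT -> k),
    centralizing_triple K H B /\ D = isotypic H B.
Proof.
move=> fusD; have [K [H [B [tr KE HE DP]]]] := fusion_isotypic fusD.
exists K, H, B; split=> //; apply/seteqP; split=> V; first exact: DP.
exact: (isotypic_mem fusD pchar_k tr KE HE DP).
Qed.

Lemma triple_groups (K H : {set gT}) (B : gT -> gT -> k) :
  centralizing_triple K H B ->
  exists K' H' : {group gT}, [/\ K = K', H = H' & centralizing_triple K' H' B].
Proof.
move=> tr; have [[gK _] [gH _] _ _ _] := tr.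
by exists (Group gK), (Group gH).
Qed.

End Triples.

Theorem theorem3p12 (k : closedFieldType) (gT : finGroupType) (R : {set gT})
    (hk : [pchar k] =i pred0)
    (hR : is_transversal R (classes [set: gT]) [set: gT]) :
  [/\ forall D : set (dmod k gT), fusion_subcategory D ->
        centralizing_triple (supp_of R D) (ker_of R D) (bichar_of R D) /\
        (forall a chi g h, in_Gamma R D a chi -> h \in ker_of R D ->
           bichar_of R D (g^-1 * a * g)%g h = chi (g * h * g^-1)%g / chi 1%g),
      forall (K H : {set gT}) (B : gT -> gT -> k), centralizing_triple K H B ->
        fusion_subcategory (S_of R K H B),
      forall D : set (dmod k gT), fusion_subcategory D ->
        S_of R (supp_of R D) (ker_of R D) (bichar_of R D) = D,
      forall (K H : {set gT}) (B : gT -> gT -> k), centralizing_triple K H B ->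
        [/\ supp_of R (S_of R K H B) = K,
            ker_of R (S_of R K H B) = H
          & bichar_of R (S_of R K H B) = B]
    & set_bij
        [set D : set (dmod k gT) | fusion_subcategory D]%classic
        [set t : {set gT} * {set gT} * (gT -> gT -> k) |
           centralizing_triple t.1.1 t.1.2 t.2]%classic
        (fun D => (supp_of R D, ker_of R D, bichar_of R D))].
Proof.
have fusion_data (D : set (dmod k gT)) : fusion_subcategory D ->
    centralizing_triple (supp_of R D) (ker_of R D) (bichar_of R D) /\
    S_of R (supp_of R D) (ker_of R D) (bichar_of R D) = D.
  move=> /(fusion_triple hk)[K [H [B [tr ->]]]].
  rewrite (supp_of_isotypic hk hR tr) (ker_of_isotypic hk hR tr).
  by rewrite (bichar_of_isotypic hk hR tr) (S_of_isotypic hk tr hR).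
have S_fusion (K H : {set gT}) (B : gT -> gT -> k) : centralizing_triple K H B ->
    fusion_subcategory (S_of R K H B).
  case/triple_groups=> K' [H' [-> -> tr]]; rewrite (S_of_isotypic hk tr hR).
  exact: isotypic_fusion tr.
have S_data (K H : {set gT}) (B : gT -> gT -> k) : centralizing_triple K H B ->
    [/\ supp_of R (S_of R K H B) = K, ker_of R (S_of R K H B) = H
      & bichar_of R (S_of R K H B) = B].
  case/triple_groups=> K' [H' [-> -> tr]]; rewrite (S_of_isotypic hk tr hR).
  rewrite (supp_of_isotypic hk hR tr) (ker_of_isotypic hk hR tr).
  by rewrite (bichar_of_isotypic hk hR tr).
split=> //.
- move=> D fusD; split; first by have [] := fusion_data D fusD.
  move: fusD => /(fusion_triple hk)[K [H [B [tr ->]]]].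
  rewrite (ker_of_isotypic hk hR tr) (bichar_of_isotypic hk hR tr).
  by move=> a chi g h GD hH; rewrite (isotypic_quotient hk tr g GD hH).
- by move=> D /fusion_data[].
split.
- by move=> D /fusion_data[].
(* Injectivity: D is recovered from its triple by [S_of]. *)
- move=> D D'; rewrite !inE => /fusion_data[_ DE] /fusion_data[_ DE'] [sE kE bE].
  by rewrite -DE -DE' sE kE bE.
case=> [[K H] B] /= tr; exists (S_of R K H B); first exact: S_fusion.
by have [-> -> ->] := S_data K H B tr.
Qed.
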